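(* If $X$ is a Banach space that is not reflexive, then there exists $f\in A_{\infty}(B_X)$ such that its Aron-Berner extension $\tilde f$ is not an element of $A_{\infty}(B_{X^{**}})$.
   Context: All Banach spaces are complex. For a Banach space $Z$, $B_Z$ is its open unit ball and $Z^{**}$ its second dual. $A_\infty(B_Z)$ is the Banach algebra (sup norm) of bounded analytic functions on $B_Z$ that extend continuously to the boundary of $B_Z$, i.e. to the closed unit ball $\overline{B_Z}$ with the norm topology. Aron-Berner extension: if $P$ is a continuous $m$-homogeneous polynomial on $Z$ with associated symmetric continuous $m$-linear form $A$, let $\tilde A(z_1^{**},\dots,z_m^{**})=\lim_{\alpha_1}\cdots\lim_{\alpha_m}A(z^1_{\alpha_1},\dots,z^m_{\alpha_m})$, where $(z^i_{\alpha_i})$ is a net in $Z$ converging weak-star to $z_i^{**}\in Z^{**}$, and $\tilde P(z^{**})=\tilde A(z^{**},\dots,z^{**})$. For a bounded analytic function $f$ on $B_Z$ with Taylor series $f=\sum_m P_m$ at $0$ ($P_m$ an $m$-homogeneous polynomial), its Aron-Berner extension is $\tilde f=\sum_m\tilde P_m$ on $B_{Z^{**}}$, a bounded analytic function. *)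

(* Defs.v *)
From HB Require Import structures.
From mathcomp Require Import all_boot all_order all_algebra all_fingroup.
From mathcomp Require Import all_classical all_reals all_analysis.
From mathcomp Require Import complex.

Set Implicit Arguments.
Unset Strict Implicit.
Unset Printing Implicit Defensive.

Import Order.TTheory GRing.Theory Num.Theory numFieldNormedType.Exports.

Local Open Scope classical_set_scope.
Local Open Scope ring_scope.
Local Open Scope complex_scope.

(* The complex field as a normed space over itself: the topology attached to
   a numFieldType is only found on the regular module R[i]^o, the norm is
   R[i]-valued. *)
Notation Cx R := (R[i]^o).

Lemma bounded_linear_fun_continuous (R : numFieldType) (V W : normedModType R)
    (f : V -> W) (M : R) :
  0 <= M -> linear f -> (forall x, `|f x| <= M * `|x|) -> continuous f.
Proof.
move=> M0 lf fM; pose f' := GRing.isLinear.Build R V W *:%R f lf.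
pose g : {linear V -> W} := HB.pack f f'.
apply: (@bounded_linear_continuous R V W g); apply/linear_boundedP.
near=> r => x; rewrite (le_trans (fM x))// ler_wpM2r//.
by near: r; apply: nbhs_pinfty_ge; exact: ger0_real.
Unshelve. all: by end_near. Qed.

Section Dual.
Variables (R : realType) (X : normedModType R[i]).

Definition continuous_functional : {pred X -> Cx R} :=
  mem [set f : X -> Cx R | linear f /\ continuous f].

Lemma continuous_functional_submod_closed :
  submod_closed continuous_functional.
Proof.
split=> [|a f g /set_mem [lf cf] /set_mem [lg cg]]; apply/mem_set; split.
- by move=> b u v /=; rewrite -[0 u]/0 -[0 v]/0 -[LHS]/0 scaler0 addr0.
- by move=> x; exact: cvg_cst.
- move=> b u v; rewrite -[LHS]/(a *: f (b *: u + v) + g (b *: u + v)).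
  rewrite -[RHS]/(b *: (a *: f u + g u) + (a *: f v + g v)) lf lg !scalerDr !scalerA (mulrC a b).
  by rewrite addrACA.
- by move=> x; apply: cvgD; [apply: cvgZl_tmp; exact: cf|exact: cg].
Qed.

HB.instance Definition _ := GRing.isSubmodClosed.Build _ _
  continuous_functional continuous_functional_submod_closed.

Record dual := Dual {
  functional :> X -> Cx R ;
  functionalP : functional \in continuous_functional }.

HB.instance Definition _ := [isSub for functional].
HB.instance Definition _ := [Choice of dual by <:].
HB.instance Definition _ := [SubChoice_isSubLmodule of dual by <:].

Implicit Types f g : dual.

Lemma dual_linear f : linear f.
Proof. by case: f => f /= /set_mem []. Qed.

Lemma dual_continuous f : continuous f.
Proof. by case: f => f /= /set_mem []. Qed.

HB.instance Definition _ f :=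
  GRing.isLinear.Build R[i] X (Cx R) *:%R f (@dual_linear f).

Lemma dual_ext f g : f =1 g -> f = g.
Proof. by move=> fg; apply/val_inj/funext. Qed.

Lemma dualDE f g x : (f + g) x = f x + g x. Proof. by []. Qed.
Lemma dualZE (a : R[i]) f x : (a *: f) x = a *: f x. Proof. by []. Qed.

Definition dual_norm f : R := sup [set complex.Re `|f x| | x in ball (0 : X) 1].

Lemma normRe (z : R[i]) : (complex.Re `|z|)%:C = `|z|.
Proof. by rewrite RRe_real ?normr_real. Qed.

Lemma dual_bounded f :
  exists2 M : R[i], 0 < M & forall x, `|f x| <= M * `|x|.
Proof.
have /linear_boundedP/pinfty_ex_gt0[M M0 fM] :=
  continuous_linear_bounded 0 (@dual_continuous f 0).
by exists M.
Qed.

Lemma dual_norm_has_ub f :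
  has_ubound [set complex.Re `|f x| | x in ball (0 : X) 1].
Proof.
have [M M0 fM] := dual_bounded f; exists (complex.Re M) => _ [x x1 <-].
rewrite -lecR normRe RRe_real ?gtr0_real// (le_trans (fM x))//.
by move: x1; rewrite -ball_normE /= sub0r normrN => /ltW; rewrite ger_pMr.
Qed.

Lemma dual_norm_ge f x : `|f x| <= (dual_norm f)%:C * `|x|.
Proof.
have [->|x0] := eqVneq x 0; first by rewrite linear0 !normr0 mulr0.
have nx0 : 0 < `|x| by rewrite normr_gt0.
rewrite -ler_pdivrMr //; set c := `|f x| / `|x|.
have cr : c \is Num.real by rewrite ger0_real// divr_ge0.
rewrite -(RRe_real cr) lecR; apply/ler_addgt0Pl => e e0.
set n := complex.Re c.
have n0 : 0 <= n by rewrite -ler0c RRe_real// divr_ge0.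
have ne0 : 0 < n + e by rewrite ltr_wpDl.
suff : n * (n / (n + e)) <= dual_norm f.
  have : n - e <= n * (n / (n + e)).
    by rewrite mulrA ler_pdivlMr// -subr_sqr -expr2 lerBlDr lerDl sqr_ge0.
  by move=> /le_trans /[apply]; rewrite lerBlDl.
set t := n / (n + e).
have t0 : 0 <= t by rewrite divr_ge0// ltW.
have t1 : t < 1 by rewrite ltr_pdivrMr// mul1r ltrDl.
clearbody t.
apply: ub_le_sup; first exact: dual_norm_has_ub.
exists ((t%:C / `|x|) *: x).
  rewrite -ball_normE /= sub0r normrN normrZ normrM normfV normr_id.
  by rewrite divfK ?gt_eqF// ger0_norm ?ler0c// -[ltRHS]/(1%:C) ltcR.
apply/eqP; rewrite eq_le -!lecR -eq_le normRe linearZ /=.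
rewrite -[(_ *: _ : Cx R)]/((t%:C / `|x|) * f x) !normrM.
rewrite normfV normr_id ger0_norm ?ler0c// rmorphM /= RRe_real//.
by rewrite /c mulrAC (mulrC t%:C) mulrAC.
Qed.

Lemma dual_norm_le f (M : R) : 0 <= M ->
  (forall x, `|f x| <= M%:C * `|x|) -> dual_norm f <= M.
Proof.
move=> M0 fM; apply: ge_sup.
  by exists (complex.Re `|f 0|), 0 => //; exact: ballxx.
move=> _ [x + <-]; rewrite -ball_normE /= sub0r normrN => /ltW x1.
by rewrite -lecR normRe (le_trans (fM x))// ler_piMr// ler0c.
Qed.

Lemma dual_norm_ge0 f : 0 <= dual_norm f.
Proof.
apply: ub_le_sup; first exact: dual_norm_has_ub.
by exists 0; [exact: ballxx|rewrite linear0 normr0].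
Qed.

Definition dual_normC f : R[i] := (dual_norm f)%:C.

Lemma dual_normC_ge0 f : 0 <= dual_normC f.
Proof. by rewrite ler0c dual_norm_ge0. Qed.

Lemma dual_norm_triangle f g :
  dual_normC (f + g) <= dual_normC f + dual_normC g.
Proof.
rewrite -rmorphD lecR; apply: dual_norm_le => [|x].
  by rewrite addr_ge0// dual_norm_ge0.
rewrite dualDE (le_trans (ler_normD _ _))// rmorphD mulrDl.
by rewrite lerD// dual_norm_ge.
Qed.

Lemma dual_normZ_le (a : R[i]) f : dual_normC (a *: f) <= `|a| * dual_normC f.
Proof.
rewrite -(normRe a) -rmorphM lecR; apply: dual_norm_le => [|x].
  by rewrite mulr_ge0 ?dual_norm_ge0// -ler0c normRe.
by rewrite dualZE normrZ rmorphM /= normRe -mulrA ler_wpM2l// dual_norm_ge.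
Qed.

Lemma dual_normZ (a : R[i]) f : dual_normC (a *: f) = `|a| * dual_normC f.
Proof.
apply/eqP; rewrite eq_le dual_normZ_le /=.
have [->|a0] := eqVneq a 0; first by rewrite normr0 mul0r dual_normC_ge0.
rewrite -ler_pdivlMl ?normr_gt0// -normfV.
by rewrite -[in leLHS](scalerK a0 f) dual_normZ_le.
Qed.

Lemma dual_norm_eq0 f : dual_normC f = 0 -> f = 0.
Proof.
move=> f0; apply: dual_ext => x; apply/eqP; rewrite -[eqbRHS]/(0 : Cx R) -normr_le0.
by rewrite (le_trans (dual_norm_ge f x))// -/(dual_normC f) f0 mul0r.
Qed.

HB.instance Definition _ := Lmodule_isNormed.Build R[i] dual
  dual_norm_triangle dual_normZ dual_norm_eq0.

Lemma dual_normE f : `|f| = (dual_norm f)%:C. Proof. by []. Qed.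

End Dual.

Arguments continuous_functional {R} X.

Notation bidual X := (dual (dual X)).

Section Bidual.
Variables (R : realType) (X : normedModType R[i]).

Lemma evaluation_continuous_functional (x : X) :
  (fun f : dual X => f x) \in continuous_functional (dual X : normedModType R[i]).
Proof.
apply/mem_set; split=> //.
apply: (@bounded_linear_fun_continuous _ (dual X) (Cx R) _ `|x|) => // f.
by rewrite mulrC dual_norm_ge.
Qed.

Definition canonical_embedding (x : X) : bidual X :=
  Dual (evaluation_continuous_functional x).

End Bidual.

Arguments canonical_embedding {R X}.

Definition reflexive_space (R : realType) (X : normedModType R[i]) := range canonical_embedding = [set: bidual X].

(* The weak-star topology: pointwise convergence on Y. *)
Definition weak_star (R : realType) (Y : normedModType R[i]) :=
  initial_topology (fun f : dual Y => (f : Y -> Cx R) : {ptws Y -> Cx R}).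

Section AronBerner.
Variables (R : realType) (X : normedModType R[i]).

(* Limits along this filter are the limits along all the nets of X whose image
   in the bidual converges weak-star to z. *)
Definition weak_star_trace (z : bidual X) : set_system X :=
  filter_from (nbhs (z : weak_star (dual X)))
    (fun V => canonical_embedding @^-1` V).

Definition multilinear m (A : ('I_m -> X) -> Cx R) :=
  forall (v : 'I_m -> X) (i : 'I_m), linear (fun x => A (dfwith v i x)).

Definition symmetric_form m (A : ('I_m -> X) -> Cx R) :=
  forall (s : {perm 'I_m}) (v : 'I_m -> X), A (v \o s) = A v.

Definition continuous_form m (A : ('I_m -> X) -> Cx R) :=
  continuous (A : {ptws 'I_m -> X} -> Cx R).

Definition associated_form m (P : X -> Cx R) (A : ('I_m -> X) -> Cx R) :=
  [/\ multilinear A, symmetric_form A, continuous_form A &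
      forall x, P x = A (fun=> x)].

Definition homogeneous_polynomial m (P : X -> Cx R) :=
  exists A : ('I_m -> X) -> Cx R, associated_form P A.

Definition ocons (T : Type) m (x : T) (v : 'I_m -> T) : 'I_m.+1 -> T :=
  fun i => oapp v x (unlift ord0 i).

(* Iterated limit: the first variable is the outermost limit. *)
Fixpoint form_extension m :
    (('I_m -> X) -> Cx R) -> ('I_m -> bidual X) -> Cx R :=
  if m is m'.+1 then fun A z =>
    lim (form_extension (fun v => A (ocons x v)) (z \o lift ord0)
           @[x --> weak_star_trace (z ord0)])
  else fun A _ => A (fun=> 0).

Definition polynomial_extension m (P : X -> Cx R) (z : bidual X) : Cx R :=
  form_extension (get (@associated_form m P)) (fun=> z).

(* Convergence is uniform on a ball; a ball leaving the domain under
   consideration is harmless since the radius can always be decreased. *)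
Definition power_series_at (f : X -> Cx R) (a : X) (P : nat -> X -> Cx R) :=
  (forall m, homogeneous_polynomial m (P m)) /\
  exists2 r : R, 0 < r & {uniform ball a r%:C,
    (fun n x => \sum_(m < n) P m (x - a)) @ \oo --> f}.

Definition analytic_on (U : set X) (f : X -> Cx R) :=
  forall a, U a -> exists P, power_series_at f a P.

(* Elements of A_infty are represented by total functions; only the values on
   the open unit ball matter. *)
Definition A_infty (f : X -> Cx R) :=
  [/\ analytic_on (ball 0 1) f,
      [bounded f x | x in ball (0 : X) 1] &
      exists2 g : X -> Cx R,
        {within [set x | `|x| <= 1], continuous g} &
        forall x, ball 0 1 x -> g x = f x].

(* The Taylor series at 0, and above the symmetric form of a polynomial, are
   determined uniquely when they exist; get merely names them. *)
Definition taylor_series (f : X -> Cx R) : nat -> X -> Cx R :=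
  get (power_series_at f 0).

Definition aron_berner (f : X -> Cx R) (z : bidual X) : Cx R :=
  lim ((fun n => \sum_(m < n) polynomial_extension m (taylor_series f m) z)
         @ \oo).

End AronBerner.

(* Main.v *)
Require Import Defs.
From mathcomp Require Import all_boot all_order all_algebra all_fingroup.
From mathcomp Require Import all_classical all_reals all_analysis complex.
From mathcomp Require Import ring lra.

(** The function is [f = g \o u], where [u] is a functional of norm one on [X]
    that does not attain its norm on the closed unit ball, and [g] is a bounded
    analytic function on the open unit disc that has no limit at [1] along the
    real radius. Since [|u x| < 1] for all [x] in the closed ball, [f] is
    continuous there, whatever the behaviour of [g] at the unit circle. The
    Aron-Berner extension is [z |-> g (z u)]. By Hahn-Banach some [z] of norm one
    in the bidual satisfies [z u = 1], so the extension takes the values [g t] at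
    the points [t z], and it has no limit at [z].

    That a nonreflexive Banach space carries such a [u] is James' theorem
    ([james_nonattaining]). Helly's theorem gives points and functionals in the
    unit balls with [f n (x k) = 0] for [k < n] and [f n (x k) = th > 0] for
    [n <= k]. Convex combinations [g n] of the far [f k] are then selected one
    after the other, so that the norm of the weighted sum of the [g n] minus a
    cluster point of the [g n] is almost as small as possible given the terms
    already chosen, and a functional built in this way cannot attain its norm.
    A separable space would allow the [f n] to be chosen weak-star null; in
    general the norm has to be insensitive to the cluster point, which is why
    the selection also shrinks the sets from which later functionals are taken.

    The function [g] is the alternating sum of [q ^+ k / (1 - w + q ^+ k)], the
    poles of which tend to [1] from outside the disc. It is bounded because the
    terms have bounded total variation in [k], and it oscillates because [G s],
    its value at [w = 1 - s], satisfies [G s + G (q s) = 1 / (1 + q s)] without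
    tending to [1 / 2] ([bounded_analytic_no_radial_limit]).

    The Aron-Berner extension is defined through the Taylor series of [f] and the
    symmetric forms of its terms, so that the formula [z |-> g (z u)] rests on
    the uniqueness of both ([taylor_unique], [associated_form_unique]) and on
    the weak-star density of [X] in its bidual
    ([weak_star_trace_proper]). *)

Set Implicit Arguments.
Unset Strict Implicit.
Unset Printing Implicit Defensive.

Import Order.TTheory GRing.Theory Num.Theory numFieldNormedType.Exports.

Local Open Scope classical_set_scope.
Local Open Scope ring_scope.
Local Open Scope complex_scope.

Local Notation rePart := complex.Re.

(** * Real-valued norms *)

Section RealNorm.
Variable R : realType.
Implicit Types (V : normedModType R[i]) (z : Cx R).

(** The library norm takes values in [R[i]]; real values allow suprema, infima
    and real arithmetic. *)
Definition nrm V (x : V) : R := rePart `|x|.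

Lemma nrmE V (x : V) : (nrm x)%:C = `|x|.
Proof. by rewrite /nrm RRe_real ?normr_real. Qed.

Lemma nrm_ge0 V (x : V) : 0 <= nrm x.
Proof. by rewrite -ler0c nrmE. Qed.

Lemma nrm0 V : nrm (0 : V) = 0.
Proof. by rewrite /nrm normr0. Qed.

Lemma nrmN V (x : V) : nrm (- x) = nrm x.
Proof. by rewrite /nrm normrN. Qed.

Lemma nrmD V (x y : V) : nrm (x + y) <= nrm x + nrm y.
Proof. by rewrite -lecR rmorphD /= !nrmE ler_normD. Qed.

Lemma nrmB V (x y : V) : nrm (x - y) <= nrm x + nrm y.
Proof. by rewrite -(nrmN y) nrmD. Qed.

Lemma nrmZ V (a : Cx R) (x : V) : nrm (a *: x) = nrm a * nrm x.
Proof. by apply: complexI; rewrite rmorphM /= !nrmE normrZ. Qed.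

Lemma nrmM (a b : Cx R) : nrm (a * b : Cx R) = nrm a * nrm b.
Proof. exact: nrmZ. Qed.

Lemma nrm_eq0 V (x : V) : nrm x = 0 -> x = 0.
Proof. by move=> x0; apply/eqP; rewrite -normr_eq0 -nrmE x0. Qed.

Lemma nrm_gt0 V (x : V) : x != 0 -> 0 < nrm x.
Proof.
by move=> x0; rewrite lt0r nrm_ge0 andbT; apply: contra_neq x0 => /nrm_eq0.
Qed.

Lemma nrm1 : nrm (1 : Cx R) = 1.
Proof. by apply: complexI; rewrite nrmE normr1. Qed.

Lemma nrmX (a : Cx R) n : nrm (a ^+ n : Cx R) = nrm a ^+ n.
Proof. by elim: n => [|n IH]; rewrite ?expr0 ?nrm1// !exprS nrmM IH. Qed.

Lemma nrmV (a : Cx R) : nrm (a^-1 : Cx R) = (nrm a)^-1.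
Proof. by apply: complexI; rewrite nrmE normfV -nrmE -fmorphV. Qed.

Lemma nrm_real (r : R) : nrm (r%:C : Cx R) = `|r|.
Proof. by rewrite /nrm normc_def /= expr0n addr0 sqrtr_sqr. Qed.

Lemma nrm_sign n : nrm ((- 1) ^+ n : Cx R) = 1.
Proof. by rewrite nrmX nrmN nrm1 expr1n. Qed.

Lemma absRe_le z : `|rePart z| <= nrm z.
Proof. by rewrite -lecR nrmE normc_ge_Re. Qed.

Lemma Re_le z : rePart z <= nrm z.
Proof. exact: le_trans (ler_norm _) (absRe_le z). Qed.

Lemma nrm_sqr z : nrm z ^+ 2 = rePart z ^+ 2 + complex.Im z ^+ 2.
Proof. by rewrite /nrm normc_def /= sqr_sqrtr// addr_ge0 ?sqr_ge0. Qed.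

Lemma absIm_le z : `|complex.Im z| <= nrm z.
Proof.
rewrite -(@ler_pXn2r _ 2) ?nnegrE ?nrm_ge0// nrm_sqr real_normK ?num_real//.
by rewrite lerDr sqr_ge0.
Qed.

Lemma ReD (a b : Cx R) : rePart (a + b : Cx R) = rePart a + rePart b.
Proof. by case: a b => [? ?] []. Qed.

Lemma ReN (a : Cx R) : rePart (- a : Cx R) = - rePart a.
Proof. by case: a. Qed.

Lemma ReB (a b : Cx R) : rePart (a - b : Cx R) = rePart a - rePart b.
Proof. by case: a b => [? ?] []. Qed.

Lemma ReZ (r : R) (a : Cx R) : rePart (r%:C * a : Cx R) = r * rePart a.
Proof. by case: a => [a b] /=; rewrite mul0r subr0. Qed.

(** Lets a bound on a modulus be read off from a bound on real parts. *)
Lemma rotation z : exists2 a : Cx R, nrm a = 1 & a * z = (nrm z)%:C.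
Proof.
have [->|z0] := eqVneq z 0; first by exists 1; rewrite ?nrm1// mulr0 nrm0.
have nz0 : (nrm z)%:C != 0 :> Cx R by rewrite nrmE normr_eq0.
exists ((nrm z)%:C / z); last by rewrite divfK.
rewrite nrmM nrmV nrm_real ger0_norm ?nrm_ge0// divff//.
by apply: contra_neq z0 => /nrm_eq0.
Qed.

End RealNorm.

Section DualNorm.
Variables (R : realType) (X : normedModType R[i]).

Lemma nrm_dualE (f : dual X) : nrm f = dual_norm f.
Proof. by []. Qed.

Lemma nrm_dual_ge (f : dual X) (x : X) : nrm (f x) <= nrm f * nrm x.
Proof. by rewrite -lecR rmorphM /= !nrmE dual_norm_ge. Qed.

Lemma nrm_dual_le (f : dual X) (M : R) : 0 <= M ->
  (forall x, nrm (f x) <= M * nrm x) -> nrm f <= M.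
Proof.
move=> M0 fM; rewrite nrm_dualE; apply: dual_norm_le => // x.
by rewrite -!nrmE -rmorphM lecR.
Qed.

Lemma nrm_dual_le1 (f : dual X) (x : X) : nrm f <= 1 -> nrm (f x) <= nrm x.
Proof.
by move=> f1; rewrite (le_trans (nrm_dual_ge f x))// ler_piMl ?nrm_ge0.
Qed.

Lemma linear_bounded_dual (F : X -> Cx R) (M : R) : 0 <= M -> linear F ->
  (forall x, nrm (F x) <= M * nrm x) ->
  exists2 f : dual X, (forall x, f x = F x) & nrm f <= M.
Proof.
move=> M0 lF FM.
have cF : F \in continuous_functional X.
  apply/mem_set; split=> //; apply: (@bounded_linear_fun_continuous _ _ _ _ M%:C) => //.
    by rewrite ler0c.
  by move=> x; rewrite -!nrmE -rmorphM lecR.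
by exists (Dual cF) => //; apply: nrm_dual_le.
Qed.

End DualNorm.

(** * The Hahn-Banach theorem *)

Section HahnBanach.
Variables (R : realType) (X : lmodType R[i]).

Definition sublinear (q : X -> R) :=
  (forall x y, q (x + y) <= q x + q y) /\
  (forall (t : R) x, 0 < t -> q (t%:C *: x) = t * q x).

Lemma sublinear0 q : sublinear q -> q 0 = 0.
Proof. by case=> _ /(_ 2%:R 0 (ltr0n _ _)); rewrite scaler0; lra. Qed.

Lemma sublinearN q x : sublinear q -> - q (- x) <= q x.
Proof.
by move=> sq; have := sq.1 x (- x); rewrite subrr sublinear0//; lra.
Qed.

(** Relaxing along [y] keeps a functional sublinear and can only lower it, so a
    minimal one is left unchanged; the term [t = 1] of the infimum then gives
    [q x + q y <= q (x + y)]. *)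
Definition relax (q : X -> R) (y x : X) : R :=
  inf [set q (x + t%:C *: y) - t * q y | t in [set t : R | 0 <= t]].

Lemma relax_lb q y x : sublinear q ->
  lbound [set q (x + t%:C *: y) - t * q y | t in [set t : R | 0 <= t]] (- q (- x)).
Proof.
move=> sq _ [t /= t0 <-].
have : q (t%:C *: y) <= q (x + t%:C *: y) + q (- x).
  by rewrite (le_trans _ (sq.1 _ _))// addrAC subrr add0r.
have {t0} [<-|t0] := predU1P (etrans (esym (le_eqVlt 0 t)) t0).
  rewrite !scale0r addr0 mul0r subr0 (sublinear0 sq); lra.
by rewrite sq.2//; lra.
Qed.

Lemma relax_le q y x t : sublinear q -> 0 <= t ->
  relax q y x <= q (x + t%:C *: y) - t * q y.
Proof.
move=> sq t0; apply: ge_inf; last by exists t.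
by exists (- q (- x)); exact: relax_lb.
Qed.

Lemma relax_leq q y x : sublinear q -> relax q y x <= q x.
Proof.
move=> sq; apply: le_trans (relax_le y x sq (lexx 0)) _.
by rewrite scale0r addr0 mul0r subr0.
Qed.

Lemma relax_adherent q y x e : sublinear q -> 0 < e ->
  exists2 t : R, 0 <= t & q (x + t%:C *: y) - t * q y < relax q y x + e.
Proof.
move=> sq e0.
have [|_ [t t0 <-] h] := @inf_adherent R
  [set q (x + t%:C *: y) - t * q y | t in [set t : R | 0 <= t]] e e0.
  split; first by eexists; exists 0 => //=.
  by exists (- q (- x)); exact: relax_lb.
by exists t.
Qed.

Lemma relax_sublinear q y : sublinear q -> sublinear (relax q y).
Proof.
move=> sq; split=> [x z|s x s0].
  apply/ler_addgt0Pl => e e0.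
  have [t t0 ht] := relax_adherent y x sq (divr_gt0 e0 (ltr0n _ 2)).
  have [s s0 hs] := relax_adherent y z sq (divr_gt0 e0 (ltr0n _ 2)).
  have := relax_le y (x + z) sq (addr_ge0 t0 s0).
  have := sq.1 (x + t%:C *: y) (z + s%:C *: y).
  rewrite addrACA -scalerDl -rmorphD /=; lra.
have half r v : 0 < r -> relax q y (r%:C *: v) <= r * relax q y v.
  move=> r0; apply/ler_addgt0Pl => e e0.
  have [t t0 ht] := relax_adherent y v sq (divr_gt0 e0 r0).
  have := relax_le y (r%:C *: v) sq (mulr_ge0 (ltW r0) t0).
  rewrite rmorphM /= -scalerA -scalerDr sq.2// => /le_trans; apply.
  rewrite -mulrA -mulrBr.
  have -> : e + r * relax q y v = r * (relax q y v + e / r).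
    by rewrite mulrDr [r * (e / r)]mulrC divfK ?gt_eqF// addrC.
  by rewrite ler_pM2l// ltW.
apply/eqP; rewrite eq_le half//=.
have := half s^-1 (s%:C *: x); rewrite invr_gt0 => /(_ s0).
rewrite scalerA -rmorphM mulVf ?gt_eqF// scale1r.
by rewrite ler_pdivlMl.
Qed.

(** Zorn's lemma for the reversed pointwise order: the infimum of a chain of
    sublinear functionals is sublinear, and it is finite because every
    [q <= p] satisfies [- p (- x) <= q x]. *)
Lemma minimal_sublinear p : sublinear p ->
  exists q, [/\ sublinear q, forall x, q x <= p x &
    forall q', sublinear q' -> (forall x, q' x <= q x) -> q' = q].
Proof.
move=> sp.
pose T := {q : X -> R | sublinear q /\ forall x, q x <= p x}.
pose le (a b : T) := `[< forall x, sval b x <= sval a x >].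
have [||||[q [sq qp]] qmin] := @Zorn T le.
- by move=> t; apply/asboolP.
- by move=> a b c /asboolP ab /asboolP bc; apply/asboolP => x; exact: le_trans (bc x) (ab x).
- move=> [a Ha] [b Hb] /asboolP /= ab /asboolP /= ba; apply: eq_exist => /=.
  by apply/funext => x; apply/eqP; rewrite eq_le ab ba.
- move=> A tA.
  have [[a0 Aa0]|A0] := pselect (exists a, A a); last first.
    exists (exist _ p (conj sp (fun x => lexx (p x)))) => s As.
    by exfalso; apply: A0; exists s.
  pose S x := [set sval a x | a in A].
  pose m x := inf (S x).
  have lbS x : has_lbound (S x).
    exists (- p (- x)) => _ [[a [sa ap]] _ <-] /=.
    by have := sublinearN x sa; have := ap (- x); lra.
  have nS x : S x !=set0 by exists (sval a0 x), a0.
  have mle a x : A a -> m x <= sval a x.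
    by move=> Aa; apply: ge_inf => //; exists a.
  have madh x e : 0 < e -> exists2 a, A a & sval a x < m x + e.
    move=> e0; have [|_ [a Aa <-] h] := @inf_adherent R (S x) e e0; first by [].
    by exists a.
  have mp x : m x <= p x.
    by apply: le_trans (mle _ _ Aa0) _; exact: (svalP a0).2.
  have sm : sublinear m.
    split=> [x y|s x s0].
      apply/ler_addgt0Pl => e e0.
      have [a Aa ha] := madh x _ (divr_gt0 e0 (ltr0n _ 2)).
      have [b Ab hb] := madh y _ (divr_gt0 e0 (ltr0n _ 2)).
      have [/asboolP ab|/asboolP ba] := tA _ _ Aa Ab.
        have := mle b (x + y) Ab; have := (svalP b).1.1 x y; have := ab x; lra.
      have := mle a (x + y) Aa; have := (svalP a).1.1 x y; have := ba y; lra.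
    have half r v : 0 < r -> m (r%:C *: v) <= r * m v.
      move=> r0; apply/ler_addgt0Pl => e e0.
      have [a Aa ha] := madh v _ (divr_gt0 e0 r0).
      have := mle a (r%:C *: v) Aa; rewrite (svalP a).1.2// => /le_trans; apply.
      have -> : e + r * m v = r * (m v + e / r).
        by rewrite mulrDr [r * (e / r)]mulrC divfK ?gt_eqF// addrC.
      by rewrite ler_pM2l// ltW.
    apply/eqP; rewrite eq_le half//=.
    have := half s^-1 (s%:C *: x); rewrite invr_gt0 => /(_ s0).
    rewrite scalerA -rmorphM mulVf ?gt_eqF// scale1r.
    by rewrite ler_pdivlMl.
  exists (exist _ m (conj sm mp)) => s As; apply/asboolP => x /=; exact: mle.
exists q; split=> // q' sq' q'q.
have q'p x : q' x <= p x by exact: le_trans (q'q x) (qp x).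
have := qmin (exist _ q' (conj sq' q'p)) => /(_ _)/(congr1 sval) /=; apply.
by apply/asboolP.
Qed.

Lemma minimal_sublinear_additive q : sublinear q ->
  (forall q', sublinear q' -> (forall x, q' x <= q x) -> q' = q) ->
  {morph q : x y / x + y} /\ forall (r : R) x, q (r%:C *: x) = r * q x.
Proof.
move=> sq qmin.
have qD : {morph q : x y / x + y}.
  move=> x y; apply/eqP; rewrite eq_le sq.1 /=.
  have := relax_le y x sq ler01.
  rewrite (qmin _ (relax_sublinear y sq)); last by move=> z; exact: relax_leq.
  rewrite scale1r; lra.
have qN x : q (- x) = - q x.
  by have := qD x (- x); rewrite subrr sublinear0//; lra.
split=> // r x; have [r0|r0|->] := ltgtP r 0.
- rewrite -[r]opprK rmorphN scaleNr qN sq.2 ?oppr_gt0//; lra.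
- exact: sq.2.
- by rewrite scale0r mul0r sublinear0.
Qed.

(** A minimal functional below [relax p x0] is linear, and at [- x0] it is at
    most [- p x0]; this forces equality with [p] at [x0]. *)
Lemma hahn_banach_real p x0 : sublinear p ->
  exists f : X -> R, [/\ {morph f : x y / x + y},
    forall (r : R) x, f (r%:C *: x) = r * f x,
    forall x, f x <= p x & f x0 = p x0].
Proof.
move=> sp; have [q [sq qp qmin]] := minimal_sublinear (relax_sublinear x0 sp).
have [qD qZ] := minimal_sublinear_additive sq qmin.
have qlep x : q x <= p x by exact: le_trans (qp x) (relax_leq x0 x sp).
exists q; split=> //; apply/eqP; rewrite eq_le qlep /=.
have := qp (- x0); have := relax_le x0 (- x0) sp ler01.
rewrite scale1r addNr (sublinear0 sp).
have -> : q (- x0) = - q x0.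
  by have := qD x0 (- x0); rewrite subrr (sublinear0 sq); lra.
lra.
Qed.

End HahnBanach.

Section ComplexHahnBanach.
Variables (R : realType) (X : normedModType R[i]).

Lemma scale_ReIm (a : R[i]) (x : X) :
  a *: x = (rePart a)%:C *: x + (complex.Im a)%:C *: ('i *: x).
Proof. by rewrite scalerA -scalerDl [in LHS](complexE a) (mulrC 'i). Qed.

(** The real functional [f] is the real part of [x |-> f x - i f (i x)], and a
    rotation turns the bound on [f] into a bound on the modulus. *)
Lemma hahn_banach_complex (p : X -> R) x0 : sublinear p ->
  (forall (a : Cx R) x, nrm a = 1 -> p (a *: x) = p x) ->
  (forall x, p x <= nrm x) ->
  exists F : dual X, [/\ nrm F <= 1, forall x, nrm (F x) <= p x &
    F x0 = (p x0)%:C].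
Proof.
move=> sp pU pn; have [f [fD fZ fp fx0]] := hahn_banach_real x0 sp.
have fN x : f (- x) = - f x.
  by rewrite -scaleN1r -[-1]/(- (1%:C)) -rmorphN fZ mulN1r.
pose F x : Cx R := f x +i* (- f ('i *: x)).
have ii x : 'i *: ('i *: x) = - x :> X.
  by rewrite scalerA -expr2 sqr_i scaleN1r.
have iC (a : R[i]) (x : X) : 'i *: (a *: x) = a *: ('i *: x).
  by rewrite !scalerA mulrC.
have lF : linear F.
  move=> a x y; rewrite (scale_ReIm a x) -[_ *: F x]/(a * F x).
  case: a => r s; rewrite /F /= !scalerDr !(iC (_%:C)) ii !fD !fZ fN.
  by apply/eqP; rewrite eq_complex /=; apply/andP; split; apply/eqP => /=; ring.
have Fp x : nrm (F x) <= p x.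
  have [a a1 aF] := rotation (F x).
  rewrite -(pU a x a1) (le_trans _ (fp _))//.
  have -> : f (a *: x) = rePart (F (a *: x)) by [].
  have F0 : F 0 = 0.
    have := lF 1 0 0; rewrite !scale1r addr0 => /eqP.
    by rewrite -subr_eq subrr eq_sym => /eqP.
  by have := lF a x 0; rewrite F0 !addr0 -[_ *: F x]/(a * F x) aF => ->.
have [G GF G1] : exists2 f : dual X, (forall x, f x = F x) & nrm f <= 1.
  by apply: linear_bounded_dual => // x; rewrite mul1r (le_trans (Fp x)).
exists G; split=> // [x|]; first by rewrite GF.
rewrite GF; have := Fp x0; rewrite -(_ : rePart (F x0) = p x0) // => h.
have : complex.Im (F x0) = 0.
  have := nrm_sqr (F x0); have := absRe_le (F x0).
  have := ler_norm (rePart (F x0)); have := nrm_ge0 (F x0).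
  move: (complex.Im _) (rePart _) (nrm _) h => i r n h n0 ra an e.
  have rn : r = n by lra.
  by move: e; rewrite rn => /eqP; rewrite addrC -subr_eq subrr eq_sym sqrf_eq0 => /eqP.
by move=> im0; apply/eqP; rewrite eq_complex /= eqxx; apply/eqP.
Qed.

(** Hahn-Banach applied to the quotient seminorm [x |-> dist (x, N)], which is
    zero on [N] and at least [d] at [x0]. *)
Lemma hahn_banach_dist (N : set X) (x0 : X) (d : R) : N 0 ->
  (forall a n m, N n -> N m -> N (a *: n + m)) ->
  (forall n, N n -> d <= nrm (x0 - n)) ->
  exists F : dual X, [/\ nrm F <= 1, forall n, N n -> F n = 0 &
    exists2 c : R, d <= c & F x0 = c%:C].
Proof.
move=> N0 NS dN.
have NZ a n : N n -> N (a *: n) by move=> Nn; rewrite -[_ *: _]addr0; apply: NS.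
have ND m n : N m -> N n -> N (m + n).
  by move=> Nm Nn; rewrite -[m]scale1r; apply: NS.
pose S x := [set nrm (x - n) | n in N].
pose p x := inf (S x).
have lbS x : lbound (S x) 0 by move=> _ [n _ <-]; exact: nrm_ge0.
have ple x n : N n -> p x <= nrm (x - n).
  by move=> Nn; apply: ge_inf; [exists 0; exact: lbS|exists n].
have padh x e : 0 < e -> exists2 n, N n & nrm (x - n) < p x + e.
  move=> e0; have [|_ [n Nn <-] h] := @inf_adherent R (S x) e e0.
    by split; [eexists; exists 0|exists 0; exact: lbS].
  by exists n.
have p0 x : 0 <= p x by apply: lb_le_inf => //; eexists; exists 0.
have pn x : p x <= nrm x by have := ple x 0 N0; rewrite subr0.
have pZ (a : Cx R) x : p (a *: x) <= nrm a * p x.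
  have [->|a0] := eqVneq a 0.
    by rewrite scale0r nrm0 mul0r -(nrm0 X); exact: pn.
  apply/ler_addgt0Pl => e e0.
  have na0 : 0 < nrm a by exact: nrm_gt0.
  have [n Nn h] := padh x _ (divr_gt0 e0 na0).
  rewrite (le_trans (ple _ _ (NZ a n Nn)))// -scalerBr nrmZ.
  have -> : e + nrm a * p x = nrm a * (p x + e / nrm a).
    by rewrite mulrDr [nrm a * (e / _)]mulrC divfK ?gt_eqF// addrC.
  by rewrite ler_pM2l// ltW.
have pZE (a : Cx R) x : a != 0 -> p (a *: x) = nrm a * p x.
  move=> a0; apply/eqP; rewrite eq_le pZ /= -ler_pdivlMl ?nrm_gt0// -nrmV.
  by rewrite -[in leLHS](scalerK a0 x) pZ.
have sp : sublinear p.
  split=> [x y|t x t0]; last first.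
    rewrite pZE ?nrm_real ?gtr0_norm//.
    by apply/eqP => /complexI t00; rewrite t00 ltxx in t0.
  apply/ler_addgt0Pl => e e0.
  have [n Nn hn] := padh x _ (divr_gt0 e0 (ltr0n _ 2)).
  have [m Nm hm] := padh y _ (divr_gt0 e0 (ltr0n _ 2)).
  have := ple (x + y) _ (ND _ _ Nn Nm); rewrite opprD addrACA.
  have := nrmD (x - n) (y - m); lra.
have [a x a1||F [F1 Fp Fx0]] := hahn_banach_complex x0 sp.
- rewrite pZE ?a1 ?mul1r//; apply/eqP => a0; move: a1.
  by rewrite a0 nrm0 => /eqP; rewrite eq_sym oner_eq0.
- exact: pn.
exists F; split=> // [n Nn|].
  apply: nrm_eq0; apply/eqP; rewrite eq_le nrm_ge0 andbT (le_trans (Fp n))//.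
  by rewrite (le_trans (ple n n Nn))// subrr nrm0.
exists (p x0) => //; apply: lb_le_inf; first by eexists; exists 0.
by move=> _ [n Nn <-]; exact: dN.
Qed.

Lemma norming_functional (x0 : X) :
  exists2 F : dual X, nrm F <= 1 & F x0 = (nrm x0)%:C.
Proof.
have [||n ->|F [F1 _ [c xc Fc]]] := @hahn_banach_dist [set 0] x0 (nrm x0).
- by [].
- by move=> a n m -> ->; rewrite scaler0 addr0.
- by rewrite subr0.
exists F => //; rewrite Fc; congr (_%:C); apply/eqP; rewrite eq_le xc andbT.
rewrite (le_trans _ (nrm_dual_le1 x0 F1))// Fc nrm_real; exact: ler_norm.
Qed.

End ComplexHahnBanach.

(** * Helly's theorem and nonreflexive spaces *)

Section Evaluation.
Variables (R : realType) (X : normedModType R[i]).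

Lemma dualDx (g h : dual X) x : (g + h) x = g x + h x. Proof. by []. Qed.
Lemma dualBx (g h : dual X) x : (g - h) x = g x - h x. Proof. by []. Qed.
Lemma dualZx a (g : dual X) x : (a *: g) x = a * g x. Proof. by []. Qed.
Lemma dual0x x : (0 : dual X) x = 0. Proof. by []. Qed.
Lemma linD (g : dual X) x y : g (x + y) = g x + g y.
Proof. exact: linearD. Qed.
Lemma linB (g : dual X) x y : g (x - y) = g x - g y.
Proof. exact: linearB. Qed.
Lemma linZ (g : dual X) a x : g (a *: x) = a * g x.
Proof. exact: linearZ. Qed.
Lemma lin0 (g : dual X) : g 0 = 0.
Proof. exact: linear0. Qed.

End Evaluation.

Section Helly.
Variables (R : realType) (X : normedModType R[i]).
Implicit Types (f : nat -> dual X) (G : bidual X).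

(** The hypothesis says that [g] is a linear combination of the [f i]; stating
    the consequence for every [G] avoids naming the coefficients. *)
Lemma common_kernel n f (g : dual X) :
  (forall x, (forall i, (i < n)%N -> f i x = 0) -> g x = 0) ->
  forall G, (forall i, (i < n)%N -> G (f i) = 0) -> G g = 0.
Proof.
elim: n g => [|n IH] g fg G Gf.
  suff -> : g = 0 by rewrite lin0.
  by apply: dual_ext => x; rewrite fg.
have [[y [fy fny]]|nfy] := pselect (exists y,
    (forall i, (i < n)%N -> f i y = 0) /\ f n y != 0); last first.
  apply: IH => [x fx|i ni]; last by apply: Gf; rewrite ltnS ltnW.
  apply: fg => i; rewrite ltnS leq_eqVlt => /predU1P[->|/fx//].
  by apply: contrapT => fnx; apply: nfy; exists x; split=> //; exact/eqP.
have /IH : forall x, (forall i, (i < n)%N -> f i x = 0) ->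
    (g - (g y / f n y) *: f n) x = 0.
  move=> x fx; rewrite dualBx dualZx.
  have := fg (x - (f n x / f n y) *: y).
  rewrite linB linZ => <-; first by congr (_ - _); rewrite mulrAC [in RHS]mulrAC (mulrC (g y)).
  move=> i; rewrite ltnS leq_eqVlt => /predU1P[->|ni]; rewrite linB linZ.
    by rewrite divfK// subrr.
  by rewrite fx// (fy i)// mulr0 subrr.
move=> /(_ G); rewrite linB linZ Gf ?ltnSn// mulr0 subr0; apply=> i ni.
by apply: Gf; rewrite ltnS ltnW.
Qed.

(** Each new functional either is nonzero on the common kernel of the previous
    ones, and the solution can be corrected there, or it depends on them and is
    matched already. *)
Lemma finite_interpolation n f G :
  exists x, forall i, (i < n)%N -> f i x = G (f i).
Proof.
elim: n => [|n [x fx]]; first by exists 0.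
have [[y [fy fny]]|nfy] := pselect (exists y,
    (forall i, (i < n)%N -> f i y = 0) /\ f n y != 0).
  exists (x + ((G (f n) - f n x) / f n y) *: y) => i.
  rewrite ltnS leq_eqVlt linD linZ => /predU1P[->|ni].
    by rewrite divfK// addrC subrK.
  by rewrite (fy i)// mulr0 addr0 fx.
exists x => i; rewrite ltnS leq_eqVlt => /predU1P[->|/fx//].
have h : (G - canonical_embedding x) (f n) = 0.
  apply: (@common_kernel n f) => [z fz|i0 ni]; last first.
    by rewrite dualBx -fx// subrr.
  by apply: contrapT => fnz; apply: nfy; exists z; split=> //; exact/eqP.
by move: h; rewrite dualBx => /eqP; rewrite subr_eq0 => /eqP ->.
Qed.

(** If the affine space of solutions stayed at distance more than [nrm G] from
    [0], Hahn-Banach would give [F] of norm at most one in the span of the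
    [f i], with [G F = F x0 > nrm G]. *)
Lemma helly n f G e : 0 < e ->
  exists2 x, nrm x <= nrm G + e & forall i, (i < n)%N -> f i x = G (f i).
Proof.
move=> e0; have [x0 fx0] := finite_interpolation n f G.
pose N := [set x | forall i, (i < n)%N -> f i x = 0].
have [[m Nm xm]|far] := pselect (exists2 m, N m & nrm (x0 - m) <= nrm G + e).
  by exists (x0 - m) => // i ni; rewrite linB Nm// subr0 fx0.
have [||m Nm|F [F1 FN [c dc Fc]]] := @hahn_banach_dist _ _ N x0 (nrm G + e).
- by move=> i _; rewrite lin0.
- by move=> a v w Nv Nw i ni; rewrite linD linZ Nv// Nw// mulr0 addr0.
- by rewrite leNgt; apply/negP => h; apply: far; exists m => //; exact: ltW.
have GF : (G - canonical_embedding x0) F = 0.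
  apply: (@common_kernel n f) => [z Nz|i ni]; first exact: FN.
  by rewrite dualBx -fx0// subrr.
have {}GF : G F = c%:C.
  by move: GF; rewrite dualBx => /eqP; rewrite subr_eq0 => /eqP ->; rewrite -Fc.
have := nrm_dual_ge G F; rewrite GF nrm_real.
have := ler_norm c; have := nrm_ge0 G; nra.
Qed.

End Helly.

Section NonReflexive.
Variables (R : realType) (X : completeNormedModType R[i]).

Lemma canonical_embeddingB (x y : X) :
  canonical_embedding x - canonical_embedding y = canonical_embedding (x - y).
Proof. by apply: dual_ext => f; rewrite dualBx -[RHS]/(f (x - y)) linB. Qed.

Lemma nrm_canonical_embedding (x : X) : nrm (canonical_embedding x) = nrm x.
Proof.
apply/eqP; rewrite eq_le; apply/andP; split.
  apply: nrm_dual_le => [|f]; first exact: nrm_ge0.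
  by rewrite mulrC; exact: (nrm_dual_ge f x).
have [F F1 Fx] := norming_functional x.
have := nrm_dual_ge (canonical_embedding x) F.
rewrite -[canonical_embedding x F]/(F x) Fx nrm_real ger0_norm ?nrm_ge0//.
by move=> /le_trans; apply; rewrite ler_piMr ?nrm_ge0.
Qed.

(** The image of the complete space [X] under an isometry is closed in the
    bidual, hence at positive distance from the points outside it. *)
Lemma nonreflexive_gap : ~ reflexive_space X ->
  exists F : bidual X, exists2 d : R, 0 < d &
    forall x, d <= nrm (F - canonical_embedding x).
Proof.
move=> nrX; apply: contrapT => close; apply: nrX; apply/seteqP; split=> // F _.
have cl e : 0 < e -> exists x, nrm (F - canonical_embedding x) < e.
  move=> e0; apply: contrapT => nx; apply: close; exists F, e => // x.
  by rewrite leNgt; apply/negP => h; apply: nx; exists x.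
have [x hx] := choice (fun n : nat => cl n.+1%:R^-1 (ltac:(by rewrite invr_gt0 ltr0n))).
have xx m n : nrm (x m - x n) < m.+1%:R^-1 + n.+1%:R^-1.
  rewrite -nrm_canonical_embedding -canonical_embeddingB.
  have -> : canonical_embedding (x m) - canonical_embedding (x n) =
      (F - canonical_embedding (x n)) - (F - canonical_embedding (x m)).
    by rewrite opprB [RHS]addrC addrA subrK.
  apply: le_lt_trans (nrmB _ _) _.
  by rewrite [ltRHS]addrC; apply: ltrD; [exact: hx n|exact: hx m].
have small e : 0 < e -> \forall n \near \oo, n.+1%:R^-1 < e :> R.
  by move=> e0; near=> n; near: n; exact: near_infty_natSinv_lt (PosNum e0).
have cx : cvg (x @ \oo).
  apply/cauchy_cvgP/cauchy_exP => e e0.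
  have e0' : 0 < rePart e by move: e0; rewrite ltcE => /andP[].
  have eE : e = (rePart e)%:C by rewrite RRe_real// gtr0_real.
  have e2 : 0 < rePart e / 2 by rewrite divr_gt0.
  have [N hN] := filter_ex (small _ e2).
  exists (x N); change (\forall n \near \oo, ball (x N) e (x n)).
  near=> n; rewrite /= -ball_normE /= -nrmE eE ltcR.
  apply: lt_trans (xx N n) _; rewrite (splitr (rePart e)) ltrD//.
  by near: n; exact: small.
exists (lim (x @ \oo)) => //.
apply/esym/eqP; rewrite -subr_eq0; apply/eqP/nrm_eq0/eqP.
rewrite eq_le nrm_ge0 andbT; apply/ler_addgt0Pl => e e0.
have e20 : 0 < e / 2 by rewrite divr_gt0.
have /cvgrPdist_lt/(_ (e / 2)%:C) := cx; rewrite -[0]/(0%:C) ltcR => /(_ e20) xl.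
suff [n [h1 h2]] : exists n, n.+1%:R^-1 < e / 2 /\ nrm (lim (x @ \oo) - x n) < e / 2.
  have -> : F - canonical_embedding (lim (x @ \oo)) =
      (F - canonical_embedding (x n)) - canonical_embedding (lim (x @ \oo) - x n).
    by rewrite -canonical_embeddingB opprB addrA subrK.
  apply: le_trans (nrmB _ _) _; rewrite nrm_canonical_embedding.
  rewrite addr0 (splitr e); apply: lerD (ltW h2).
  exact/ltW/(lt_trans (hx n)).
have [n [h1 h2]] := filter_ex (filterI (small _ e20) xl).
by exists n; split=> //; rewrite -ltcR nrmE.
Unshelve. all: by end_near. Qed.

(** James' triangular systems. Given [F] in the bidual away from [X], the
    functional [f n] comes from Helly's theorem for the dual of the bidual: it
    imitates a functional annihilating [X] but not [F], so it kills the previous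
    points while [F (f n) = th]. Then [x n] comes from Helly's theorem for the
    bidual: it imitates [F] on the functionals found so far. *)
Lemma nonreflexive_system : ~ reflexive_space X ->
  exists th : R, exists f : nat -> dual X, exists x : nat -> X,
  [/\ 0 < th, forall n, nrm (f n) <= 1, forall n, nrm (x n) <= 1,
      forall n k, (k < n)%N -> f n (x k) = 0 &
      forall n k, (n <= k)%N -> f n (x k) = th%:C].
Proof.
move=> /nonreflexive_gap[F [d d0 Fd]].
pose nF := nrm F.
have nF0 : 0 <= nF := nrm_ge0 F.
(* [F] is rescaled to norm at most one half, which leaves room for the error
   term of Helly's theorem in the unit balls. *)
pose c := (2 * nF + 1)^-1.
have c0 : 0 < c by rewrite invr_gt0; lra.
pose F' : bidual X := c%:C *: F.
have F'12 : nrm F' <= 1 / 2.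
  rewrite nrmZ nrm_real gtr0_norm// -/nF /c ler_pdivrMl; lra.
pose d' := c * d.
have d'0 : 0 < d' by exact: mulr_gt0.
have F'd x : d' <= nrm (F' - canonical_embedding x).
  have -> : F' - canonical_embedding x =
      c%:C *: (F - canonical_embedding (c^-1%:C *: x)).
    rewrite scalerBr; congr (_ - _); apply: dual_ext => f.
    rewrite dualZx -[LHS]/(f x) -[canonical_embedding _ f]/(f (c^-1%:C *: x)) linZ mulrA -rmorphM.
    by rewrite divff ?gt_eqF// mul1r.
  by rewrite nrmZ nrm_real gtr0_norm// ler_pM2l.
have [||_ [x _ <-]|G [G1 GN [b db GF]]] :=
    @hahn_banach_dist _ _ (range (@canonical_embedding R X)) F' d'.
- by exists 0 => //; apply: dual_ext => f; rewrite -[LHS]/(f 0) lin0.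
- move=> a _ _ [x _ <-] [y _ <-]; exists (a *: x + y) => //.
  by apply: dual_ext => f; rewrite -[LHS]/(f (a *: x + y)) linD linZ.
- exact: F'd.
have b0 : 0 < b by exact: lt_le_trans db.
pose th := d' / 2.
have th0 : 0 < th by rewrite divr_gt0.
pose G' := (th / b)%:C *: G.
have G'12 : nrm G' <= 1 / 2.
  rewrite nrmZ nrm_real gtr0_norm ?divr_gt0//.
  apply: (@le_trans _ _ (th / b * 1)).
    by rewrite ler_pM2l// divr_gt0.
  by rewrite mulr1 ler_pdivrMr// /th; lra.
have half0 : 0 < 1 / 2 :> R by lra.
have stepf n (p : nat -> X) : exists f : dual X,
    [/\ nrm f <= 1, forall k, (k < n)%N -> f (p k) = 0 & F' f = th%:C].
  pose Fs i := if (i < n)%N then canonical_embedding (p i) else F'.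
  have [f f1 fE] := helly n.+1 Fs G' half0.
  exists f; split=> [|k kn|]; first by apply: le_trans f1 _; lra.
    have := fE k (ltnW kn); rewrite /Fs kn => h.
    by rewrite -[LHS]/(canonical_embedding (p k) f) h dualZx GN ?mulr0//; exists (p k).
  have := fE n (ltnSn n); rewrite /Fs ltnn => ->.
  by rewrite dualZx GF -rmorphM divfK// gt_eqF.
have stepx n (g : nat -> dual X) : exists x : X, nrm x <= 1 /\
    forall i, (i < n)%N -> g i x = F' (g i).
  have [x x1 xE] := helly n g F' half0.
  by exists x; split=> //; apply: le_trans x1 _; lra.
have [phi phiP] := choice (fun np : nat * (nat -> X) => stepf np.1 np.2).
have [psi psiP] := choice (fun ng : nat * (nat -> dual X) => stepx ng.1 ng.2).
(* The two choices alternate, each depending on the whole history. *)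
pose fx s : dual X * X :=
  let f := phi (size s, fun k => (nth (0, 0) s k).2) in
  (f, psi ((size s).+1, fun k => (nth (0, 0) (rcons s (f, 0)) k).1)).
pose hist := fix hist n := if n is m.+1 then rcons (hist m) (fx (hist m)) else [::].
have size_hist n : size (hist n) = n by elim: n => //= n IH; rewrite size_rcons IH.
pose u n := fx (hist n).
have nth_hist n k : (k < n)%N -> nth (0, 0) (hist n) k = u k.
  elim: n => // n IH; rewrite ltnS leq_eqVlt => /predU1P[->|kn] /=.
    by rewrite nth_rcons size_hist ltnn eqxx.
  by rewrite nth_rcons size_hist kn IH.
have uf n : [/\ nrm (u n).1 <= 1, forall k, (k < n)%N -> (u n).1 (u k).2 = 0 &
    F' (u n).1 = th%:C].
  have [h1 h2 h3] := phiP (size (hist n), fun k => (nth (0, 0) (hist n) k).2).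
  split=> // k kn; move: (h2 k); rewrite /= size_hist => /(_ kn).
  by rewrite nth_hist// -size_hist.
exists th, (fun n => (u n).1), (fun n => (u n).2); split=> // [n|n|n k kn|n k nk].
- by have [] := uf n.
- by have [] := psiP ((size (hist n)).+1,
    fun k => (nth (0, 0) (rcons (hist n) ((u n).1, 0)) k).1).
- by have [_ /(_ _ kn)] := uf n.
have H : (n < (size (hist k)).+1)%N ->
    (nth (0, 0) (rcons (hist k) ((u k).1, 0)) n).1 (u k).2 =
    F' (nth (0, 0) (rcons (hist k) ((u k).1, 0)) n).1.
  by have [_] := psiP ((size (hist k)).+1,
    fun i => (nth (0, 0) (rcons (hist k) ((u k).1, 0)) i).1); apply.
move: H; rewrite size_hist ltnS => /(_ nk).
have -> : (nth (0, 0) (rcons (hist k) ((u k).1, 0)) n).1 = (u n).1.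
  rewrite nth_rcons size_hist; move: nk; rewrite leq_eqVlt => /predU1P[->|nk].
    by rewrite ltnn eqxx.
  by rewrite nk nth_hist.
by have [_ _ ->] := uf n.
Qed.

End NonReflexive.

(** * Generalized limits *)

Section GeneralizedLimit.
Variable R : realType.
Implicit Types a b : nat -> Cx R.

Lemma ultra_fmap T U (f : T -> U) (F : set_system T) :
  UltraFilter F -> UltraFilter (f @ F).
Proof.
move=> FU; split; first exact: fmap_proper_filter.
move=> G GF sFG; apply/seteqP; split=> // A GA.
have [//|FnA] := in_ultra_setVsetC (f @^-1` A) FU.
have GnA : G (~` A) by apply: sFG.
by have [x []] := filter_ex (filterI GA GnA).
Qed.

Lemma bounded_ultra_cvg (U : set_system nat) (a : nat -> R) (M : R) :
  UltraFilter U -> (forall n, `|a n| <= M) -> cvg (a @ U).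
Proof.
move=> UU aM; have sc := @segment_compact R (- M) M.
move: sc; rewrite compact_ultra => /(_ (a @ U) (ultra_fmap a UU))[|p [_ ap]].
  by apply: (@filterS _ U _ setT) => [n _|]; [rewrite /= in_itv /= -ler_norml|exact: filterT].
by apply/cvg_ex; exists p.
Qed.

Definition bounded_seq a := exists M : R, forall n, nrm (a n) <= M.

Lemma bounded_seqD a b : bounded_seq a -> bounded_seq b ->
  bounded_seq (fun n => a n + b n).
Proof.
move=> [M aM] [N bN]; exists (M + N) => n.
by rewrite (le_trans (nrmD _ _))// lerD.
Qed.

Lemma bounded_seqZ (c : Cx R) a : bounded_seq a -> bounded_seq (fun n => c * a n).
Proof.
by move=> [M aM]; exists (nrm c * M) => n; rewrite nrmM ler_wpM2l ?nrm_ge0.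
Qed.

Lemma bounded_seq_cst (c : Cx R) : bounded_seq (fun=> c).
Proof. by exists (nrm c). Qed.

(** A limit for all bounded sequences, as given by a nonprincipal ultrafilter.
    It provides weak-star cluster points of bounded sequences of functionals,
    and sums of the absolutely convergent series used below. *)
Definition generalized_limit (L : (nat -> Cx R) -> Cx R) :=
  [/\ forall c : Cx R, L (fun=> c) = c,
      forall a b, bounded_seq a -> bounded_seq b ->
        L (fun n => a n + b n) = L a + L b,
      forall (c : Cx R) a, bounded_seq a -> L (fun n => c * a n) = c * L a &
      forall a (M : R) N, bounded_seq a -> (forall n, (N <= n)%N -> rePart (a n) <= M) ->
        rePart (L a) <= M].

Lemma generalized_limit_exists : exists L, generalized_limit L.
Proof.
have [U [UU ooU]] := ultraFilterLemma (eventually_filter : ProperFilter \oo).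
pose L a : Cx R := lim ((fun n => rePart (a n)) @ U) +i* lim ((fun n => complex.Im (a n)) @ U).
have cRe a : bounded_seq a -> cvg ((fun n => rePart (a n)) @ U).
  move=> [M aM]; apply: (@bounded_ultra_cvg _ _ M) => n.
  exact: le_trans (absRe_le _) (aM n).
have cIm a : bounded_seq a -> cvg ((fun n => complex.Im (a n)) @ U).
  move=> [M aM]; apply: (@bounded_ultra_cvg _ _ M) => n.
  exact: le_trans (absIm_le _) (aM n).
have ImD (x y : Cx R) : complex.Im (x + y : Cx R) = complex.Im x + complex.Im y.
  by case: x y => [? ?] [].
exists L; split=> [c|a b ba bb|c a ba|a M N ba aM].
- by rewrite /L !lim_cst//; case: c.
- rewrite /L; apply/eqP; rewrite eq_complex /=; apply/andP; split; apply/eqP.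
    rewrite -limD; [|exact: cRe..]; congr (lim (_ @ U)); apply/funext => n.
    exact: ReD.
  rewrite -limD; [|exact: cIm..]; congr (lim (_ @ U)); apply/funext => n.
  exact: ImD.
- rewrite /L; case: c => r s.
  have cvRe k : (fun n => k * rePart (a n)) @ U --> k * lim ((fun n => rePart (a n)) @ U).
    by apply: cvgMr; exact: cRe.
  have cvIm k : (fun n => k * complex.Im (a n)) @ U -->
      k * lim ((fun n => complex.Im (a n)) @ U).
    by apply: cvgMr; exact: cIm.
  apply/eqP; rewrite eq_complex /=; apply/andP; split; apply/eqP.
    apply/cvg_lim => //; rewrite (_ : (fun n => _) =
      (fun n => r * rePart (a n)) - (fun n => s * complex.Im (a n))).
      exact: cvgB.
    by apply/funext => n; rewrite !fctE; case: (a n).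
  apply/cvg_lim => //; rewrite (_ : (fun n => _) =
    (fun n => r * complex.Im (a n)) + (fun n => s * rePart (a n))).
    exact: cvgD.
  by apply/funext => n; rewrite !fctE; case: (a n).
- apply: limr_le; first exact: cRe.
  by apply: (ooU [set n | rePart (a n) <= M]); exists N => // n; exact: aM.
Qed.

End GeneralizedLimit.

Section GeneralizedLimitTheory.
Variables (R : realType) (L : (nat -> Cx R) -> Cx R).
Hypothesis HL : generalized_limit L.
Implicit Types a b : nat -> Cx R.

Lemma glim_cst (c : Cx R) : L (fun=> c) = c.
Proof. by case: HL. Qed.

Lemma glimD a b : bounded_seq a -> bounded_seq b ->
  L (fun n => a n + b n) = L a + L b.
Proof. by case: HL => _ h _ _; exact: h. Qed.

Lemma glimZ (c : Cx R) a : bounded_seq a -> L (fun n => c * a n) = c * L a.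
Proof. by case: HL => _ _ h _; exact: h. Qed.

Lemma glim_Re_le a (M : R) N : bounded_seq a ->
  (forall n, (N <= n)%N -> rePart (a n) <= M) -> rePart (L a) <= M.
Proof. by case: HL => _ _ _ h; exact: h. Qed.

Lemma glimN a : bounded_seq a -> L (fun n => - a n) = - L a.
Proof.
move=> ba; rewrite -mulN1r -glimZ//; congr L.
by apply/funext => n; rewrite mulN1r.
Qed.

Lemma bounded_seqN a : bounded_seq a -> bounded_seq (fun n => - a n).
Proof. by move=> [M aM]; exists M => n; rewrite nrmN. Qed.

Lemma glimB a b : bounded_seq a -> bounded_seq b ->
  L (fun n => a n - b n) = L a - L b.
Proof. by move=> ba bb; rewrite glimD ?glimN//; exact: bounded_seqN. Qed.

Lemma glim_Re_ge a (M : R) N : bounded_seq a ->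
  (forall n, (N <= n)%N -> M <= rePart (a n)) -> M <= rePart (L a).
Proof.
move=> ba aM; rewrite -lerN2 -ReN -glimN//; apply: (@glim_Re_le _ _ N).
  exact: bounded_seqN.
by move=> n Nn; rewrite ReN lerN2 aM.
Qed.

Lemma glim_nrm_le a (M : R) N : bounded_seq a ->
  (forall n, (N <= n)%N -> nrm (a n) <= M) -> nrm (L a) <= M.
Proof.
move=> ba aM; have [c c1 cL] := rotation (L a).
have <- : rePart (c * L a : Cx R) = nrm (L a) by rewrite cL.
rewrite -glimZ//; apply: (@glim_Re_le _ _ N); first exact: bounded_seqZ.
by move=> n Nn; rewrite (le_trans (Re_le _))// nrmM c1 mul1r aM.
Qed.

Lemma glim_sum (I : Type) (r : seq I) (F : I -> nat -> Cx R) :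
  (forall i, bounded_seq (F i)) ->
  bounded_seq (fun n => \sum_(i <- r) F i n) /\
  L (fun n => \sum_(i <- r) F i n) = \sum_(i <- r) L (F i).
Proof.
move=> bF; elim: r => [|i r [IHb IHL]].
  rewrite big_nil; under eq_fun do rewrite big_nil.
  by split; [exact: bounded_seq_cst|exact: glim_cst].
rewrite big_cons; under eq_fun do rewrite big_cons.
by split; [exact: bounded_seqD|rewrite glimD// IHL].
Qed.

Lemma glim_dual (X : normedModType R[i]) (f : nat -> dual X) (M : R) :
  (forall n, nrm (f n) <= M) ->
  exists2 g : dual X, (forall x, g x = L (fun n => f n x)) & nrm g <= M.
Proof.
move=> fM; have M0 : 0 <= M := le_trans (nrm_ge0 _) (fM 0).
have fx n x : nrm (f n x) <= M * nrm x.
  by rewrite (le_trans (nrm_dual_ge _ _))// ler_wpM2r ?nrm_ge0.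
have bf x : bounded_seq (fun n => f n x) by exists (M * nrm x).
apply: linear_bounded_dual => //.
  move=> c x y; rewrite -[_ *: L _]/(c * L _) -glimZ// -glimD//; last exact: bounded_seqZ.
  by congr L; apply/funext => n; rewrite linD linZ.
by move=> x; apply: (@glim_nrm_le _ _ 0).
Qed.

End GeneralizedLimitTheory.

(** * James' theorem *)

Section James.
Variables (R : realType) (X : normedModType R[i]).
Implicit Types (K : nat -> set (dual X)) (f g h : dual X) (u : X).

(** Decreasing nonempty convex sets of functionals of norm at most one; they
    play the part of a sequence of functionals and of its convex blocks, and
    passing to a subsequence becomes passing to smaller sets. *)
Definition convex_tower K :=
  [/\ forall n f, K n f -> nrm f <= 1, forall n, K n !=set0,
      forall n, K n.+1 `<=` K n &
      forall n f g (t : R), K n f -> K n g -> 0 <= t -> t <= 1 ->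
        K n (t%:C *: f + (1 - t)%:C *: g)].

Definition subtower K' K := forall n, K' n `<=` K n.

Lemma tower_le K m n : convex_tower K -> (m <= n)%N -> K n `<=` K m.
Proof.
move=> [_ _ KS _] /subnK <-; elim: (n - m)%N => // k IH f Kf; exact/IH/KS.
Qed.

(** The supremum over the unit ball of [h u] minus the lower limit of [f u] down
    the tower is at most [c]: then [h] exceeds by at most [c] every cluster
    point of a sequence running down the tower. *)
Definition dominated K h (c : R) :=
  forall u, nrm u <= 1 -> forall d : R, 0 < d ->
    exists n, forall f, K n f -> rePart ((h - f) u) <= c + d.

Lemma dominated_sub K K' h c : subtower K' K -> dominated K h c -> dominated K' h c.
Proof.
move=> sK hK u u1 d d0; have [n hn] := hK u u1 d d0.
by exists n => f /sK /hn.
Qed.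

Lemma dominated_ge0 K h c : convex_tower K -> dominated K h c -> 0 <= c.
Proof.
move=> [_ K0 _ _] hK; apply/ler_addgt0Pl => d d0; rewrite addrC.
have [|n hn] := hK 0 _ d d0; first by rewrite nrm0.
by have [f /hn] := K0 n; rewrite lin0.
Qed.

Definition choices K h (r : R) n : set R :=
  [set c | exists K' g, [/\ convex_tower K', subtower K' K, K n g &
    dominated K' (h + r%:C *: g) c]].

(** The least bound that can be reached by completing the partial convex
    combination [h] with a single member of the tower carrying the whole
    remaining mass [r], and by shrinking the tower. *)
Definition value K h r n : R := inf (choices K h r n).

Lemma choices_lb K h r n : lbound (choices K h r n) 0.
Proof. by move=> c [K' [g [cK' _ _]]] /(dominated_ge0 cK'). Qed.

Lemma choices_nonempty K h r n : convex_tower K -> choices K h r n !=set0.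
Proof.
move=> cK; have [K1 K0 _ _] := cK; have [g Kg] := K0 n.
exists (nrm (h + r%:C *: g) + 1), K, g; split=> //; first by move=> m f.
move=> u u1 d d0; exists 0 => f Kf.
rewrite dualBx ReB; have := Re_le (- f u); rewrite ReN nrmN => h1.
have h2 := nrm_dual_le1 u (K1 _ _ Kf).
have h3 := Re_le ((h + r%:C *: g) u); have h4 := nrm_dual_ge (h + r%:C *: g) u.
have h5 : nrm (h + r%:C *: g) * nrm u <= nrm (h + r%:C *: g).
  by rewrite ler_piMr ?nrm_ge0.
lra.
Qed.

(** Failure of domination is witnessed by one point [u] of the ball: the members
    of the tower that are far below [h] at [u] form a smaller tower. *)
Lemma not_dominated_cut K h c : convex_tower K -> ~ dominated K h c ->
  exists K' u, [/\ convex_tower K', subtower K' K, nrm u <= 1 &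
    forall n f, K' n f -> c <= rePart ((h - f) u)].
Proof.
move=> [K1 K0 KS KC] ndom.
have [u [u1 hu]] : exists u, nrm u <= 1 /\
    forall n, exists2 f, K n f & c <= rePart ((h - f) u).
  apply: contrapT => nu; apply: ndom => u u1 d d0; apply: contrapT => nn.
  apply: nu; exists u; split=> // n; apply: contrapT => nf; apply: nn; exists n => f Kf.
  rewrite leNgt; apply/negP => cf; apply: nf; exists f => //.
  by rewrite ltW// (lt_trans _ cf)// ltrDl.
exists (fun n => K n `&` [set f | c <= rePart ((h - f) u)]), u.
split=> //; last by move=> n f [].
  split=> [n f []|n|n f [/KS]|n f g t [Kf cf] [Kg cg] t0 t1] //.
  - by move=> /K1.
  - by have [f] := hu n; exists f.
  split; first exact: KC.
  suff : c <= rePart ((h - (t%:C *: f + (1 - t)%:C *: g)) u) by [].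
  have {}cf : c <= rePart ((h - f) u) by [].
  have {}cg : c <= rePart ((h - g) u) by [].
  rewrite dualBx dualDx !dualZx ReB ReD !ReZ; move: cf cg.
  by rewrite !dualBx !ReB; nra.
Qed.

(** An almost optimal choice of [g] is also almost optimal from below on a
    suitable subtower, since no subtower can do better than [value]. *)
Lemma tower_step K h r n e : convex_tower K -> 0 < e ->
  exists K' g u, [/\ convex_tower K' /\ subtower K' K, K n g,
    dominated K' (h + r%:C *: g) (value K h r n + e), nrm u <= 1 &
    forall j f, K' j f -> value K h r n - e <= rePart ((h + r%:C *: g - f) u)].
Proof.
move=> cK e0.
have [|c [K1 [g [cK1 K1K Kg dom]]] ce] := @inf_adherent R (choices K h r n) e e0.
  by split; [exact: choices_nonempty|exists 0; exact: choices_lb].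
have nd : ~ dominated K1 (h + r%:C *: g) (value K h r n - e).
  move=> d; suff : value K h r n <= value K h r n - e by lra.
  by apply: ge_inf; [exists 0; exact: choices_lb|exists K1, g].
have [K2 [u [cK2 K2K1 u1 hu]]] := not_dominated_cut cK1 nd.
exists K2, g, u; split=> //; first by split=> // m f /K2K1 /K1K.
apply: dominated_sub K2K1 _ => v v1 d d0; have [m hm] := dom v v1 d d0.
exists m => f /hm /le_trans; apply; rewrite lerD2r ltW//.
Qed.

(** Spending mass in two steps is a special case of spending it at once, by
    convexity of the tower; so the optimal bounds increase along the
    construction. *)
Lemma value_mono K K' h (b r : R) n g : convex_tower K -> convex_tower K' ->
  subtower K' K -> K n g -> 0 <= b -> 0 < r ->
  value K h (b + r) n <= value K' (h + b%:C *: g) r n.+1.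
Proof.
move=> cK cK' K'K Kg b0 r0; apply: lb_le_inf; first exact: choices_nonempty.
move=> c [K2 [g' [cK2 K2K' K'g' dom]]]; apply: ge_inf.
  by exists 0; exact: choices_lb.
have br0 : 0 < b + r by lra.
pose t := b / (b + r).
have tE : 1 - t = r / (b + r).
  by rewrite /t -[1](@divff _ (b + r)) ?gt_eqF// -mulrBl addrC addKr.
have t0 : 0 <= t by rewrite divr_ge0 // ltW.
have t1 : t <= 1 by rewrite ler_pdivrMr// mul1r lerDl ltW.
exists K2, (t%:C *: g + (1 - t)%:C *: g'); split=> //.
- by move=> m f /K2K' /K'K.
- have [_ _ KS KC] := cK; apply: KC => //; exact/KS/K'K.
rewrite scalerDr !scalerA -!rmorphM tE /t.
rewrite [(b + r) * (b / _)]mulrC [(b + r) * (r / _)]mulrC !divfK ?gt_eqF//.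
by rewrite addrA.
Qed.

End James.

Section JamesSequence.
Variables (R : realType) (X : normedModType R[i]).

(** At stage [n] the functional [g n] is chosen almost optimally for the
    remaining mass [c ^+ n], but only the share [(1 - c) * c ^+ n] of it is
    spent. The error [e n] is small even compared with the mass left after this
    stage, as the comparison of consecutive tails requires. *)
Lemma james_sequence (K0 : nat -> set (dual X)) (c eta : R) :
  convex_tower K0 -> 0 < c -> c < 1 -> 0 < eta ->
  exists K : nat -> nat -> set (dual X), exists h g : nat -> dual X,
  exists x : nat -> X, let al n := value (K n) (h n) (c ^+ n) n in
  let e n := c ^+ n.+1 * (eta / 2 ^+ n.+1) in
  [/\ K 0 = K0 /\ h 0 = 0,
      forall n, convex_tower (K n) /\ subtower (K n.+1) (K n),
      forall n, K n n (g n) /\ h n.+1 = h n + ((1 - c) * c ^+ n)%:C *: g n,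
      forall n, dominated (K n.+1) (h n + (c ^+ n)%:C *: g n) (al n + e n) &
      forall n, nrm (x n) <= 1 /\ forall j f, K n.+1 j f ->
        al n - e n <= rePart ((h n + (c ^+ n)%:C *: g n - f) (x n))].
Proof.
move=> cK0 c0 c1 eta0; pose e n := c ^+ n.+1 * (eta / 2 ^+ n.+1).
have e0 n : 0 < e n by rewrite mulr_gt0 ?exprn_gt0 ?divr_gt0.
pose S := (nat -> set (dual X))%type.
pose good (p : nat * S * dual X) (q : S * dual X * X) :=
  convex_tower p.1.2 -> let: (n, K, h) := p in let: (K', g, u) := q in
  [/\ convex_tower K' /\ subtower K' K, K n g,
    dominated K' (h + (c ^+ n)%:C *: g) (value K h (c ^+ n) n + e n), nrm u <= 1 &
    forall j f, K' j f ->
      value K h (c ^+ n) n - e n <= rePart ((h + (c ^+ n)%:C *: g - f) u)].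
have exq p : exists q, good p q.
  case: p => -[n K] h.
  have [cK|ncK] := pselect (convex_tower K); last first.
    by exists (K, 0, 0) => cK; exfalso; exact: ncK.
  have [K' [g [u H]]] := tower_step h (c ^+ n) n cK (e0 n).
  by exists (K', g, u).
have [F FP] := choice exq.
pose st := fix st n : S * dual X := if n is m.+1 then
  let q := F (m, (st m).1, (st m).2) in
  (q.1.1, (st m).2 + ((1 - c) * c ^+ m)%:C *: q.1.2) else (K0, 0).
pose q n := F (n, (st n).1, (st n).2).
have cst n : convex_tower (st n).1.
  elim: n => //= n IH; have := FP (n, (st n).1, (st n).2) IH.
  by case: (F _) => [[K' g] u] [[]].
have qP n := FP (n, (st n).1, (st n).2) (cst n).
exists (fun n => (st n).1), (fun n => (st n).2), (fun n => (q n).1.2), (fun n => (q n).2).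
split=> // n; have := qP n; rewrite /q /=; case: (F _) => [[K' g] u] /= [[? ?] ? ? ? ?] //.
Qed.

End JamesSequence.

Section JamesTheorem.
Variables (R : realType) (X : normedModType R[i]).

(** James' theorem for a triangular system. With [h] the weighted sum of the
    [g n] and [w] a weak-star cluster point of them, the functional is
    [z = h - w]. Every [value] is at most [nrm z]. If [z] attained its norm at
    [u], near optimality of [g n] would bound [(g n - w) u] from above by the
    tail average of the later [(g m - w) u], up to a small error. Hence the tail
    averages would not decrease along the sequence, up to a small error, and
    would stay above [th] minus a small amount. As the weights decrease fast, [g n]
    dominates its tail, so [(g n - w) u >= th / 2] for all [n], although [w] is
    a cluster point of [g]. *)
Lemma james_nonattaining (th : R) (f : nat -> dual X) (x : nat -> X) :
  0 < th -> (forall n, nrm (f n) <= 1) -> (forall n, nrm (x n) <= 1) ->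
  (forall n k, (k < n)%N -> f n (x k) = 0) ->
  (forall n k, (n <= k)%N -> f n (x k) = th%:C) ->
  exists2 z : dual X, 0 < nrm z & forall u, nrm u <= 1 -> nrm (z u) < nrm z.
Proof.
move=> th0 f1 x1 fx0 fxth.
have th1 : th <= 1.
  have := nrm_dual_le1 (x 0) (f1 0); rewrite fxth// nrm_real gtr0_norm// => h.
  exact: le_trans (x1 0).
pose K0 n := [set g : dual X | [/\ nrm g <= 1,
  forall k, (k < n)%N -> g (x k) = 0 &
  exists N, forall k, (N <= k)%N -> g (x k) = th%:C]].
have cK0 : convex_tower K0.
  split=> [n g []//|n|n g [g1 g0 gN]|n g g' t [g1 g0 [N gN]] [g'1 g'0 [N' gN']] t0 t1].
  - by exists (f n); split=> // [k /fx0//|]; exists n => k /fxth.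
  - by split=> // k kn; apply: g0; rewrite ltnS ltnW.
  - have t1' : 0 <= 1 - t by lra.
    split=> [|k kn|].
    + rewrite (le_trans (nrmD _ _))// !nrmZ !nrm_real !ger0_norm//; nra.
    + by rewrite dualDx !dualZx g0// g'0// !mulr0 addr0.
    exists (maxn N N') => k; rewrite geq_max => /andP[Nk N'k].
    rewrite dualDx !dualZx gN// gN'// -!rmorphM -rmorphD; congr (_%:C); ring.
(* Members of [K0 0] are eventually [th] on the points [x k], while each point
   is killed by the deep members of the tower. *)
have val0 : th <= value K0 0 1 0.
  apply: lb_le_inf; first exact: choices_nonempty.
  move=> c [K' [g [cK' K'K0 [g1 _ [N gN]] dom]]].
  apply/ler_addgt0Pl => d d0; have [m hm] := dom (x N) (x1 N) d d0.
  have [_ K'0 _ _] := cK'; have [g' K'g'] := K'0 (maxn m N.+1).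
  have := hm g' (tower_le cK' (leq_maxl _ _) K'g').
  have [_ g'0 _] := K'K0 _ _ (tower_le cK' (leq_maxr _ _) K'g').
  rewrite add0r scale1r dualBx gN// g'0// subr0 /=; lra.
(* Chosen so that [th - eta - 2 * c = th / 2]. *)
pose c := th / 8; pose eta := th / 4.
have c0 : 0 < c by rewrite /c; lra.
have c1 : c < 1 by rewrite /c; lra.
have eta0 : 0 < eta by rewrite /eta; lra.
have [K [h [g [y [[KE hE] KP gP domP yP]]]]] := james_sequence cK0 c0 c1 eta0.
pose al n := value (K n) (h n) (c ^+ n) n.
pose e n := c ^+ n.+1 * (eta / 2 ^+ n.+1).
pose k n := h n + (c ^+ n)%:C *: g n.
have {}domP n : dominated (K n.+1) (k n) (al n + e n) by exact: domP.
have {yP} [y1 yP] : (forall n, nrm (y n) <= 1) /\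
    forall n j f, K n.+1 j f -> al n - e n <= rePart ((k n - f) (y n)).
  by split=> n; [exact: (yP n).1|exact: (yP n).2].
have cn0 n : 0 < c ^+ n by rewrite exprn_gt0.
have c1' : 0 <= 1 - c by lra.
have al0 : th <= al 0 by rewrite /al KE hE expr0.
have alS n : al n <= al n.+1.
  rewrite /al (gP n).2.
  have cE : c ^+ n = (1 - c) * c ^+ n + c ^+ n.+1 by rewrite exprS; ring.
  have b0 : 0 <= (1 - c) * c ^+ n := mulr_ge0 c1' (ltW (cn0 n)).
  have := value_mono (h n) (KP n).1 (KP n.+1).1 (KP n).2 (gP n).1 b0 (cn0 n.+1).
  by rewrite -cE.
clearbody al.
have al_mono m n : (m <= n)%N -> al m <= al n.
  by move=> /subnK <-; elim: (n - m)%N => // i IH; exact: le_trans (alS _).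
have Kdec m n j : (m <= n)%N -> K n j `<=` K m j.
  move=> /subnK <-; elim: (n - m)%N => // i IH w Kw; apply: IH.
  exact: (KP (i + m)%N).2.
have gK n m j : (n <= m)%N -> (j <= m)%N -> K n j (g m).
  move=> nm jm; apply: (tower_le (KP n).1 jm); apply: (Kdec _ _ _ nm).
  exact: (gP m).1.
have g1 n : nrm (g n) <= 1.
  have [[K1 _ _ _] _] := KP n; exact: K1 (gP n).1.
have hh i n : nrm (h (i + n)%N - h n) <= c ^+ n - c ^+ (i + n).
  elim: i => [|i IH]; first by rewrite subrr nrm0 subrr.
  rewrite addSn (gP _).2 addrAC (le_trans (nrmD _ _))//.
  rewrite nrmZ nrm_real ger0_norm; last exact: mulr_ge0 c1' (ltW (cn0 _)).
  have := g1 (i + n)%N; rewrite exprS; move: IH.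
  move: (nrm (h _ - h _)) (cn0 (i + n)%N) => a; move: (c ^+ (i + n)) => b b0 ab gb.
  have : (1 - c) * b * nrm (g (i + n)%N) <= (1 - c) * b.
    by rewrite ler_piMr//; exact: mulr_ge0 c1' (ltW b0).
  lra.
have h1 n : nrm (h n) <= 1.
  have := hh n 0; rewrite addn0 hE subr0 expr0; have := cn0 n; lra.
have [L HL] := @generalized_limit_exists R.
have [H HE _] := glim_dual HL h1.
have [w wE w1] := glim_dual HL g1.
have bx (F : nat -> dual X) (F1 : forall n, nrm (F n) <= 1) u : bounded_seq (fun n => F n u).
  exists (nrm u) => n; exact: nrm_dual_le1.
have bh u := bx h h1 u; have bg u := bx g g1 u.
have Hh n u : nrm u <= 1 -> nrm (H u - h n u) <= c ^+ n.
  move=> u1; rewrite HE -[h n u](glim_cst HL) -(glimB HL)//; last exact: bounded_seq_cst.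
  apply: (glim_nrm_le HL (N := n)) => [|m nm].
    by apply: bounded_seqD => //; exact: bounded_seq_cst.
  rewrite -dualBx (le_trans (nrm_dual_ge _ _))// -(subnK nm).
  have := hh (m - n)%N n; have := cn0 (m - n + n)%N.
  have := nrm_ge0 (h (m - n + n)%N - h n); have := nrm_ge0 u; nra.
have bk (v : dual X) u : bounded_seq (fun n => (v - g n) u).
  have [M bM] := bg u; exists (nrm (v u) + M) => n.
  by rewrite dualBx (le_trans (nrmB _ _))// lerD2l.
have kw (v : dual X) u : (v - w) u = L (fun n => (v - g n) u).
  by rewrite dualBx wE -[v u in LHS](glim_cst HL) -(glimB HL)//; exact: bounded_seq_cst.
have lower n : al n - e n <= rePart ((k n - w) (y n)).
  rewrite kw; apply: (glim_Re_ge HL (N := n.+1)) => // m nm.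
  by apply: (yP n 0); exact: gK.
have upper n u : nrm u <= 1 -> rePart ((k n - w) u) <= al n + e n.
  move=> u1; apply/ler_addgt0Pl => d d0; rewrite [leRHS]addrC.
  have [j hj] := domP n u u1 d d0.
  rewrite kw; apply: (glim_Re_le HL (N := maxn n.+1 j)) => // m.
  by rewrite geq_max => /andP[nm jm]; apply: hj; exact: gK.
pose z := H - w.
have en n : e n <= c ^+ n.
  rewrite /e exprS mulrAC -[leRHS]mul1r ler_wpM2r ?ltW//.
  have : eta / 2 ^+ n.+1 <= 1.
    rewrite ler_pdivrMr ?exprn_gt0// mul1r (@le_trans _ _ 1) ?exprn_ege1//; last lra.
    by rewrite /eta; lra.
  have : 0 < eta / 2 ^+ n.+1 by rewrite divr_gt0 ?exprn_gt0.
  nra.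
have alz n : al n <= nrm z.
  apply/ler_addgt0Pl => d d0.
  have cv : (fun n => c ^+ n) @ \oo --> (0 : R) by apply: cvg_expr; rewrite gtr0_norm.
  have [N _ hN] : \forall n \near \oo, c ^+ n < d / 3.
    by apply: (cvgr_lt _ cv); rewrite divr_gt0.
  pose m := maxn n N.
  have := al_mono n m (leq_maxl _ _).
  have := hN m (leq_maxr _ _) => /=.
  have := lower m; have := en m; have := Hh m (y m) (y1 m).
  have := le_trans (Re_le (z (y m))) (nrm_dual_ge z (y m)).
  have : nrm z * nrm (y m) <= nrm z by rewrite ler_piMr ?nrm_ge0// (y1 m).
  rewrite !dualBx dualDx dualZx !ReB ReD ReZ.
  have := nrm_dual_le1 (y m) (g1 m); have := (y1 m).
  have := Re_le (g m (y m)); have := absRe_le (H (y m) - h m (y m)).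
  rewrite ReB ler_norml => /andP[]; have := cn0 m.
  move: (rePart (g m (y m))) (nrm (g m (y m))) (c ^+ m) => a b cm cm0 ? ? ? ? ? ? ?.
  have : cm * a <= cm by nra.
  lra.
have z0 : 0 < nrm z by apply: lt_le_trans (alz 0); exact: lt_le_trans al0.
exists z => // u0 u01; rewrite ltNge; apply/negP => zu0.
have [a a1 az] := rotation (z u0).
pose u := a *: u0.
have u1 : nrm u <= 1 by rewrite nrmZ a1 mul1r.
have zu : nrm z <= rePart (z u) by rewrite linZ az.
pose W := rePart (w u).
(* The real part at [u] of the tail, from [n] on, of the series defining [z]. *)
pose T n := rePart (H u) - rePart (h n u) - c ^+ n * W.
have W1 : `|W| <= 1.
  exact: le_trans (absRe_le _) (le_trans (nrm_dual_le1 u w1) u1).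
pose ga n := rePart (g n u) - W.
have TS n : T n = (1 - c) * c ^+ n * ga n + T n.+1.
  by rewrite /T /ga (gP n).2 dualDx dualZx ReD ReZ exprS; ring.
have T2 n : T n.+1 <= 2 * (c * c ^+ n).
  have := Hh n.+1 u u1; have := Re_le (H u - h n.+1 u); rewrite ReB /T.
  move: W1; rewrite ler_norml => /andP[? ?]; have := cn0 n.+1.
  move: (rePart (H u) - _) => q; rewrite exprS; move: (c * c ^+ n) => b; nra.
have gaT n : c ^+ n * ga n <= T n + e n.
  have := upper n u u1; have := alz n; move: zu; rewrite /k !dualBx dualDx dualZx.
  rewrite !ReB ReD ReZ /T /ga -/W; lra.
have Tlow n : c ^+ n * (th - eta * (1 - (2 ^+ n)^-1)) <= T n.
  elim: n => [|n IH].
    rewrite !expr0 invr1 subrr mulr0 subr0 mul1r /T hE dual0x expr0 mul1r.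
    rewrite -[rePart 0]/(0 : R).
    have := al0; have := alz 0; move: zu; rewrite dualBx ReB -/W. lra.
  have := TS n; have := gaT n; rewrite /e.
  have -> : eta / 2 ^+ n.+1 = eta * (2 ^+ n)^-1 / 2.
    by rewrite exprS invfM; ring.
  have -> : (2 ^+ n.+1)^-1 = (2 ^+ n)^-1 / 2 :> R by rewrite exprS invfM; ring.
  have := cn0 n; move: IH; rewrite exprS.
  have : 0 < (2 ^+ n)^-1 :> R by rewrite invr_gt0 exprn_gt0.
  move: (2 ^+ n)^-1 (c ^+ n) (ga n) (T n) (T n.+1) => p b G t t' p0 IH b0 H1 H2.
  have : (1 - c) * (b * G) <= (1 - c) * (t + c * b * (eta * p / 2)).
    by rewrite ler_pM2l//; lra.
  have : c * (b * (th - eta * (1 - p))) <= c * t by rewrite ler_pM2l.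
  have : 0 <= c * (c * b * (eta * p / 2)).
    by rewrite !mulr_ge0// ?ltW// mulr_gt0.
  nra.
have galow n : th / 2 <= ga n.
  have := Tlow n; have := TS n; have := T2 n; have := cn0 n.
  have : 0 < (2 ^+ n)^-1 :> R by rewrite invr_gt0 exprn_gt0.
  move: (2 ^+ n)^-1 (c ^+ n) (ga n) (T n) (T n.+1) => p b G t t' p0 b0 H1 H2 H3.
  have H4 : b * (th / 2) <= b * ((1 - c) * G).
    have : 0 <= b * (eta * p) by rewrite !mulr_ge0 ?ltW.
    have : b * (th / 2) = b * (th - eta - 2 * c) by rewrite /eta /c; congr (_ * _); lra.
    nra.
  move: H4; rewrite ler_pM2l// => H4.
  have G0 : 0 < G by rewrite -(@pmulr_rgt0 _ (1 - c)); lra.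
  nra.
have : W + th / 2 <= W.
  rewrite {2}/W wE; apply: (glim_Re_ge HL (N := 0)) => // n _.
  by have := galow n; rewrite /ga; lra.
lra.
Qed.

End JamesTheorem.

(** * A bounded analytic function on the disc without radial limit *)

Section PoleSum.
Variable R : realType.
Implicit Types (s w a h : Cx R) (k n K : nat).

(* With this ratio the first two poles alone push the value of the series at
   [s = 1 / 4] above [1 / 2]. *)
Let q : R := 1 / 16.
Let eps k : R := q ^+ k.

Let q0 : 0 < q. Proof. by rewrite /q; lra. Qed.

Lemma eps_gt0 k : 0 < eps k.
Proof. exact: exprn_gt0 q0. Qed.

Lemma eps_dec k : eps k.+1 <= eps k.
Proof. by have := eps_gt0 k; rewrite /eps exprS /q; lra. Qed.

Lemma sum_eps K : \sum_(k < K) eps k <= 2.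
Proof.
suff : \sum_(k < K) eps k <= 2 - 2 * eps K by have := eps_gt0 K; lra.
elim: K => [|K IH]; first by rewrite big_ord0 /eps expr0; lra.
by rewrite big_ord_recr /=; move: IH (eps_gt0 K); rewrite /eps exprS /q; lra.
Qed.

(** The variable is [s = 1 - w], positive real part standing for the disc. Each
    pole is a function close to [0] for [s] much larger than [eps k], and close
    to [1] for [s] much smaller: an alternating sum of them oscillates. *)
Definition pole k s : Cx R := (eps k)%:C / (s + (eps k)%:C).

Definition pole_sum K s : Cx R := \sum_(k < K) (- 1) ^+ k * pole k s.

Lemma nrm_shift_sqr s (e : R) :
  nrm (s + e%:C : Cx R) ^+ 2 = nrm s ^+ 2 + 2 * e * rePart s + e ^+ 2.
Proof. by rewrite !nrm_sqr; case: s => x y /=; rewrite addr0; ring. Qed.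

Lemma nrm_shift_ge s (e : R) : 0 <= rePart s -> 0 <= e -> nrm s <= nrm (s + e%:C : Cx R).
Proof.
move=> s0 e0; rewrite -(@ler_pXn2r _ 2) ?nnegrE ?nrm_ge0// nrm_shift_sqr.
have : 0 <= e * rePart s by rewrite mulr_ge0.
have := sqr_ge0 e; lra.
Qed.

Lemma nrm_shift_ge_e s (e : R) : 0 <= rePart s -> e <= nrm (s + e%:C : Cx R).
Proof. by move=> s0; apply: le_trans (Re_le _); rewrite ReD /=; lra. Qed.

Lemma nrm_shift_ge_half s (e : R) : 0 <= rePart s -> 0 <= e ->
  (nrm s + e) ^+ 2 <= 2 * nrm (s + e%:C : Cx R) ^+ 2.
Proof.
move=> s0 e0; rewrite nrm_shift_sqr.
have : 0 <= e * rePart s by rewrite mulr_ge0.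
have := sqr_ge0 (nrm s - e); nra.
Qed.

Lemma shift_neq0 s (e : R) : 0 <= rePart s -> 0 < e -> s + e%:C != 0 :> Cx R.
Proof.
move=> s0 e0; apply/eqP => se; have := nrm_shift_ge_e e s0.
by rewrite se nrm0; lra.
Qed.

Lemma nrm_pole_le1 k s : 0 <= rePart s -> nrm (pole k s) <= 1.
Proof.
move=> s0; have e0 := eps_gt0 k.
rewrite nrmM nrmV nrm_real gtr0_norm// ler_pdivrMr ?mul1r ?nrm_shift_ge_e//.
exact: lt_le_trans e0 (nrm_shift_ge_e _ s0).
Qed.

Lemma nrm_pole_le k s : 0 < rePart s -> nrm (pole k s) <= eps k / nrm s.
Proof.
move=> s0; have e0 := eps_gt0 k.
have ns0 : 0 < nrm s by exact: lt_le_trans s0 (Re_le s).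
rewrite nrmM nrmV nrm_real gtr0_norm// ler_pM2l// lef_pV2 ?posrE//.
  by apply: nrm_shift_ge; exact: ltW.
exact: lt_le_trans e0 (nrm_shift_ge_e _ (ltW s0)).
Qed.

(** The total variation of [k |-> pole k s] is controlled by that of its
    monotone real analogue [|s| / (|s| + eps k)], which stays between 0 and 1. *)
Lemma nrm_pole_sub k s : 0 < rePart s ->
  nrm (pole k s - pole k.+1 s) <=
  2 * (nrm s / (nrm s + eps k.+1) - nrm s / (nrm s + eps k)).
Proof.
move=> s0; have e0 := eps_gt0 k; have e1 := eps_gt0 k.+1.
have ed := eps_dec k; rewrite /pole.
move: (eps k) (eps k.+1) e0 e1 ed => e e' e0 e'0 ee'.
have ns0 : 0 < nrm s by exact: lt_le_trans s0 (Re_le s).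
have se := shift_neq0 (ltW s0) e0; have se' := shift_neq0 (ltW s0) e'0.
have -> : e%:C / (s + e%:C) - e'%:C / (s + e'%:C) =
    s * (e - e')%:C / ((s + e%:C) * (s + e'%:C)) :> Cx R.
  by rewrite rmorphB /=; field; rewrite se se'.
have -> : nrm s / (nrm s + e') - nrm s / (nrm s + e) =
    nrm s * (e - e') / ((nrm s + e) * (nrm s + e')).
  by field; rewrite !gt_eqF//; lra.
have ee0 : 0 <= e - e' by lra.
rewrite nrmM nrmV !nrmM nrm_real ger0_norm// mulrCA ler_wpM2l//.
  by rewrite mulr_ge0 ?nrm_ge0.
have n1 : 0 < nrm (s + e%:C : Cx R) by exact: nrm_gt0.
have n2 : 0 < nrm (s + e'%:C : Cx R) by exact: nrm_gt0.
have h1 := nrm_shift_ge_half (ltW s0) (ltW e0).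
have h2 := nrm_shift_ge_half (ltW s0) (ltW e'0).
rewrite -ler_pdivrMl ?ltr0n// -invfM lef_pV2 ?posrE ?mulr_gt0//; try lra.
rewrite -(@ler_pXn2r _ 2) ?nnegrE ?mulr_ge0//; try lra.
rewrite !exprMn.
move: h1 h2; have := sqr_ge0 (nrm s + e); have := sqr_ge0 (nrm s + e').
move: ((nrm s + e) ^+ 2) ((nrm s + e') ^+ 2) (nrm (s + e%:C : Cx R) ^+ 2) (nrm (s + e'%:C : Cx R) ^+ 2).
by move=> A B C D B0 A0 h1 h2; nra.
Qed.

Lemma nrm_pole_sum K s : 0 < rePart s -> nrm (pole_sum K s) <= 2.
Proof.
move=> s0.
have ns0 : 0 < nrm s by exact: lt_le_trans s0 (Re_le s).
pose V k := nrm s / (nrm s + eps k).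
have V0 k : 0 <= V k by rewrite divr_ge0 ?ltW// ltr_wpDr// ?ltW// eps_gt0.
have V1 k : V k <= 1.
  have e0 := eps_gt0 k; rewrite ler_pdivrMr; lra.
(* Averaging consecutive partial sums turns alternation into a telescope. *)
pose E K := 2%:R * pole_sum K s + (- 1) ^+ K * pole K s.
have ES n : E n.+1 = E n + (- 1) ^+ n * (pole n s - pole n.+1 s).
  by rewrite /E /pole_sum big_ord_recr /= exprS; ring.
have nE n : nrm (E n) <= 1 + 2 * (V n - V 0%N).
  elim: n => [|n IH].
    rewrite /E /pole_sum big_ord0 mulr0 add0r expr0 mul1r subrr mulr0 addr0.
    exact/nrm_pole_le1/ltW.
  rewrite ES (le_trans (nrmD _ _))// nrmM nrm_sign mul1r.
  have := nrm_pole_sub n s0; rewrite -/(V n) -/(V n.+1); lra.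
have : nrm (2%:R * pole_sum K s) <= nrm (E K) + 1.
  have -> : 2%:R * pole_sum K s = E K - (- 1) ^+ K * pole K s by rewrite /E; ring.
  rewrite (le_trans (nrmB _ _))// lerD2l nrmM nrm_sign mul1r.
  exact/nrm_pole_le1/ltW.
have -> : nrm (2%:R * pole_sum K s : Cx R) = 2 * nrm (pole_sum K s).
  by rewrite nrmM -(rmorph_nat (real_complex R)) nrm_real normr_nat.
have := nE K; have := V0 0; have := V1 K; lra.
Qed.

Variable L : (nat -> Cx R) -> Cx R.
Hypothesis HL : generalized_limit L.

Let G s : Cx R := L (pole_sum^~ s).

Let bG s : 0 < rePart s -> bounded_seq (pole_sum^~ s).
Proof. by move=> s0; exists 2 => K; exact: nrm_pole_sum. Qed.

Lemma nrm_G s : 0 < rePart s -> nrm (G s) <= 2.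
Proof.
by move=> s0; apply: (glim_nrm_le HL (N := 0) (bG s0)) => K _; exact: nrm_pole_sum.
Qed.

Lemma nrm_G_far s : 0 < rePart s -> nrm (G s) <= 2 / nrm s.
Proof.
move=> s0; apply: (glim_nrm_le HL (N := 0) (bG s0)) => K _.
have ns0 : 0 < nrm s by exact: lt_le_trans s0 (Re_le s).
apply: (@le_trans _ _ (\sum_(k < K) eps k / nrm s)).
  rewrite /pole_sum; elim: K => [|K IH]; first by rewrite !big_ord0 nrm0.
  rewrite !big_ord_recr /= (le_trans (nrmD _ _))// lerD// nrmM nrm_sign mul1r.
  exact: nrm_pole_le.
by rewrite -mulr_suml ler_pM2r ?invr_gt0// sum_eps.
Qed.

Lemma glim_null (a : nat -> Cx R) : bounded_seq a -> 
  (forall d : R, 0 < d -> exists N, forall n, (N <= n)%N -> nrm (a n) <= d) -> L a = 0.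
Proof.
move=> ba a0; apply: nrm_eq0; apply/eqP; rewrite eq_le nrm_ge0 andbT.
apply/ler_addgt0Pl => d /a0[N aN]; rewrite addr0.
exact: (glim_nrm_le HL (N := N)).
Qed.

(** Rescaling by the ratio of the poles shifts the alternating series by one
    term. *)
Lemma G_functional_equation (r : R) : 0 < r ->
  G r%:C + G (q * r)%:C = ((1 + q * r)^-1)%:C.
Proof.
move=> r0; have qr0 : 0 < q * r by rewrite mulr_gt0.
have R1 : 0 < rePart (r%:C : Cx R) by [].
have R2 : 0 < rePart ((q * r)%:C : Cx R) by [].
have poleS k : pole k.+1 (q * r)%:C = pole k r%:C.
  rewrite /pole -!rmorphD -!fmorphV -!rmorphM /eps exprS -mulrDr; congr (_%:C).
  have := eps_gt0 k; rewrite /eps => e0; field.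
  by rewrite !gt_eqF//; lra.
have E K : pole_sum K r%:C + pole_sum K (q * r)%:C =
    ((1 + q * r)^-1)%:C - (- 1) ^+ K * pole K (q * r)%:C.
  have <- : \sum_(k < K.+1) (- 1) ^+ k * pole k (q * r)%:C -
      (- 1) ^+ K * pole K (q * r)%:C = pole_sum K (q * r)%:C.
    by rewrite big_ord_recr /= addrK.
  rewrite big_ord_recl addrA expr0 mul1r; congr (_ - _).
  rewrite addrCA [X in _ + X](_ : _ = 0) ?addr0.
    by rewrite /pole /eps expr0 -rmorphD -fmorphV mul1r addrC.
  rewrite /pole_sum -big_split big1// => k _ /=.
  by rewrite poleS /= exprS; ring.
rewrite -(glimD HL); [|exact: bG..].
under [X in L X]eq_fun do rewrite E.
have bp : bounded_seq (fun K => (- 1) ^+ K * pole K (q * r)%:C).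
  by exists 1 => K; rewrite nrmM nrm_sign mul1r nrm_pole_le1// ltW.
rewrite (glimB HL)//; last exact: bounded_seq_cst.
rewrite (glim_cst HL) glim_null ?subr0// => d d0.
have cv : (fun n => q ^+ n) @ \oo --> (0 : R) by apply: cvg_expr; rewrite gtr0_norm// /q; lra.
have dqr : 0 < d * (q * r) by rewrite mulr_gt0.
have [N _ hN] := cvgr_lt _ cv _ dqr.
exists N => n /hN /= hn; rewrite nrmM nrm_sign mul1r.
rewrite (le_trans (nrm_pole_le _ R2))// nrm_real gtr0_norm//.
by rewrite ler_pdivrMr// ltW.
Qed.

(** By the functional equation a limit would be [1 / 2]; but along
    [s = 1 / 4 * q ^+ (2 * n)] the values increase, starting at about [3 / 5]. *)
Lemma G_no_limit (l : R) :
  ~ forall d : R, 0 < d -> exists2 e : R, 0 < e &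
      forall r : R, 0 < r -> r < e -> `|rePart (G r%:C) - l| < d.
Proof.
move=> lim_l.
have FE r : 0 < r -> rePart (G r%:C) + rePart (G (q * r)%:C) = (1 + q * r)^-1.
  by move=> r0; rewrite -ReD G_functional_equation.
have step r : 0 < r -> rePart (G r%:C) <= rePart (G (q * (q * r))%:C).
  move=> r0; have qr0 : 0 < q * r by rewrite mulr_gt0.
  have qqr0 : 0 < q * (q * r) by rewrite mulr_gt0.
  have := FE r r0; have := FE (q * r) qr0.
  have : (1 + q * r)^-1 <= (1 + q * (q * r))^-1.
    by rewrite lef_pV2 ?posrE; rewrite /q; lra.
  lra.
have start : 11 / 20 <= rePart (G (1 / 4)%:C).
  have h4 := FE 4 (ltr0n _ 4); have h64 := FE 64 (ltr0n _ 64).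
  have := nrm_G_far (s := (64%:R)%:C); rewrite /= ltr0n => /(_ isT).
  have := absRe_le (G (64%:R)%:C); rewrite nrm_real normr_nat ler_norml => /andP[].
  move: h4 h64; have -> : q * 4 = 1 / 4 by rewrite /q; lra.
  have -> : q * 64 = 4 by rewrite /q; lra.
  have -> : (1 + 1 / 4)^-1 = 4 / 5 :> R by field.
  have -> : (1 + 4)^-1 = 1 / 5 :> R by field.
  lra.
have iter n : 11 / 20 <= rePart (G (q ^+ (2 * n) * (1 / 4))%:C).
  elim: n => [|n IH]; first by rewrite muln0 expr0 mul1r.
  rewrite mulnS exprD -mulrA expr2 -mulrA.
  by apply: le_trans IH (step _ _); rewrite mulr_gt0 ?exprn_gt0//; lra.
have [e e0 he] := lim_l (1 / 100) ltac:(lra).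
have cv : (fun n => q ^+ n) @ \oo --> (0 : R) by apply: cvg_expr; rewrite gtr0_norm// /q; lra.
pose e' := Num.min e (1 / 100).
have e'0 : 0 < e' by rewrite lt_min e0; lra.
have [N _ hN] := cvgr_lt _ cv _ e'0.
pose r := q ^+ (2 * N) * (1 / 4).
have qN : q ^+ (2 * N) < e' by apply: hN => /=; rewrite leq_pmull.
have qN0 : 0 < q ^+ (2 * N) by rewrite exprn_gt0.
have r0 : 0 < r by rewrite mulr_gt0//; lra.
have re' : r < e' by rewrite /r; lra.
have [re r100] : r < e /\ r < 1 / 100 by apply/andP; rewrite -lt_min.
have := iter N; rewrite -/r => h1.
have := he r r0 re; have := he (q * r); rewrite mulr_gt0// => /(_ isT).
have -> : q * r < e by rewrite /q; lra.
move=> /(_ isT); rewrite !ltr_norml => /andP[? ?] /andP[? ?].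
have := FE r r0.
have : (1 + q * r)^-1 <= 1 by rewrite invf_le1 /q; lra.
lra.
Qed.

(* The Taylor coefficients at [s], the variable being [h = w - a]. *)
Let coef s m : Cx R := L (fun K => \sum_(k < K) (- 1) ^+ k * ((eps k)%:C / (s + (eps k)%:C) ^+ m.+1)).

(** For each pole the remainder of the geometric series is explicit. *)
Lemma G_expansion s h n : 0 < rePart s -> 0 < rePart (s - h) -> nrm h < nrm s ->
  nrm (G (s - h) - \sum_(m < n) coef s m * h ^+ m) <=
  2 * (nrm h / nrm s) ^+ n / (nrm s - nrm h).
Proof.
move=> s0 sh0 hs.
have ns0 : 0 < nrm s by exact: lt_le_trans s0 (Re_le s).
pose C m K := \sum_(k < K) (- 1) ^+ k * ((eps k)%:C / (s + (eps k)%:C) ^+ m.+1) : Cx R.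
have sum_le (F : nat -> Cx R) (M : R) K : 0 <= M -> (forall k, nrm (F k) <= eps k * M) ->
    nrm (\sum_(k < K) (- 1) ^+ k * F k : Cx R) <= 2 * M.
  move=> M0 FM; apply: (@le_trans _ _ (\sum_(k < K) eps k * M)).
    elim: K => [|K IH]; first by rewrite !big_ord0 nrm0.
    rewrite !big_ord_recr /= (le_trans (nrmD _ _))// lerD// nrmM nrm_sign mul1r.
    exact: FM.
  by rewrite -mulr_suml ler_wpM2r// sum_eps.
have ge_s k : nrm s <= nrm (s + (eps k)%:C : Cx R).
  by apply: nrm_shift_ge; apply: ltW => //; exact: eps_gt0.
have bC m : bounded_seq (C m).
  exists (2 * (nrm s ^+ m.+1)^-1) => K.
  apply: (sum_le (fun k => (eps k)%:C / (s + (eps k)%:C) ^+ m.+1)) => [|k].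
    by rewrite invr_ge0 exprn_ge0// nrm_ge0.
  rewrite nrmM nrmV nrmX nrm_real gtr0_norm ?eps_gt0// ler_pM2l ?eps_gt0//.
  rewrite lef_pV2 ?posrE ?exprn_gt0//; last exact: lt_le_trans (ge_s k).
  by rewrite lerXn2r ?nnegrE ?nrm_ge0.
have bCh (m : 'I_n) : bounded_seq (fun K => h ^+ m * C m K) by exact: bounded_seqZ.
have [bS LS] := glim_sum HL (index_enum 'I_n) bCh.
have -> : \sum_(m < n) coef s m * h ^+ m = L (fun K => \sum_(m < n) h ^+ m * C m K).
  by rewrite LS; apply: eq_bigr => m _; rewrite (glimZ HL)// mulrC.
rewrite -(glimB HL)//; last exact: bG.
apply: (glim_nrm_le HL (N := 0)) => [|K _].
  by apply: bounded_seqD; [exact: bG|exact: bounded_seqN].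
have shk k : s - h + (eps k)%:C != 0 by apply: shift_neq0; [exact: ltW|exact: eps_gt0].
have sk k : s + (eps k)%:C != 0 by apply: shift_neq0; [exact: ltW|exact: eps_gt0].
have -> : pole_sum K (s - h) - \sum_(m < n) h ^+ m * C m K =
    \sum_(k < K) (- 1) ^+ k *
      ((eps k)%:C * (h / (s + (eps k)%:C)) ^+ n / (s - h + (eps k)%:C)).
  have -> : \sum_(m < n) h ^+ m * C m K = \sum_(k < K) (- 1) ^+ k *
      \sum_(m < n) h ^+ m * ((eps k)%:C / (s + (eps k)%:C) ^+ m.+1).
    under eq_bigr do rewrite mulr_sumr.
    rewrite exchange_big /=; apply: eq_bigr => k _; rewrite mulr_sumr.
    by apply: eq_bigr => m _; rewrite mulrCA.
  rewrite /pole_sum -sumrB; apply: eq_bigr => k _; rewrite -mulrBr; congr (_ * _).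
  rewrite /pole; move: (eps k)%:C (sk k) (shk k) => e se she.
  elim: n {bCh bS LS} => [|n IH]; first by rewrite big_ord0 subr0 expr0 mulr1.
  rewrite big_ord_recr /= opprD addrA IH !exprS expr_div_n.
  have : (s + e) ^+ n != 0 by rewrite expf_neq0.
  move: (h ^+ n) ((s + e) ^+ n) => u v v0.
  by field; rewrite v0 se she.
have M0 : 0 <= (nrm h / nrm s) ^+ n / (nrm s - nrm h).
  by rewrite divr_ge0 ?exprn_ge0 ?divr_ge0 ?nrm_ge0//; lra.
rewrite -mulrA; apply: (sum_le (fun k => (eps k)%:C *
  (h / (s + (eps k)%:C)) ^+ n / (s - h + (eps k)%:C))) => // k.
rewrite !nrmM !nrmV nrmX nrmM nrmV nrm_real gtr0_norm ?eps_gt0// -mulrA.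
rewrite ler_pM2l ?eps_gt0//.
have sk0 : 0 < nrm (s + (eps k)%:C : Cx R) := lt_le_trans ns0 (ge_s k).
apply: ler_pM.
- by rewrite exprn_ge0// divr_ge0 ?nrm_ge0.
- by rewrite invr_ge0 nrm_ge0.
- rewrite lerXn2r ?nnegrE ?divr_ge0 ?nrm_ge0//.
  by rewrite ler_wpM2l ?nrm_ge0// lef_pV2 ?posrE.
have hle : nrm s - nrm h <= nrm (s - h + (eps k)%:C : Cx R).
  have := ge_s k; have := nrmD (s - h + (eps k)%:C : Cx R) h.
  have -> : s - h + (eps k)%:C + h = s + (eps k)%:C by rewrite addrAC subrK.
  lra.
rewrite lef_pV2 ?posrE//; last by lra.
by apply: lt_le_trans hle; lra.
Qed.

End PoleSum.

(** The explicit bound on Taylor remainders, at every centre [a] of the disc,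
    gives at once analyticity, continuity, and convergence of the Taylor series
    at [0] on the whole disc. *)
Lemma bounded_analytic_no_radial_limit (R : realType) :
  exists g : Cx R -> Cx R,
  [/\ forall w : Cx R, nrm w < 1 -> nrm (g w) <= 2,
      forall a : Cx R, nrm a < 1 -> exists c : nat -> Cx R,
        forall (h : Cx R) (n : nat),
        let rho := nrm (1 - a : Cx R) in nrm h < rho -> nrm (a + h : Cx R) < 1 ->
        nrm (g (a + h) - \sum_(m < n) c m * h ^+ m) <=
          2 * (nrm h / rho) ^+ n / (rho - nrm h) &
      forall l : R, ~ forall d : R, 0 < d -> exists2 e : R, 0 < e &
        forall t : R, 1 - e < t -> t < 1 -> `|rePart (g t%:C) - l| < d].
Proof.
have [L HL] := @generalized_limit_exists R.
have Re1 (w : Cx R) : nrm w < 1 -> 0 < rePart (1 - w : Cx R).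
  by move=> w1; rewrite ReB /=; have := Re_le w; lra.
exists (fun w => L (fun K => pole_sum K (1 - w))); split.
- by move=> w w1; apply: nrm_G => //; exact: Re1.
- move=> a a1; exists (fun m => L (fun K => \sum_(k < K) (- 1) ^+ k *
    (((1 / 16) ^+ k)%:C / (1 - a + ((1 / 16) ^+ k)%:C) ^+ m.+1))) => h n rho hrho ah1.
  rewrite opprD addrA; apply: G_expansion => //; first exact: Re1.
  by rewrite -addrA -opprD; exact: Re1.
move=> l lim_l; apply: (@G_no_limit R L HL l) => d /lim_l[e e0 he].
exists e => // r r0 re; have := he (1 - r).
by rewrite rmorphB /= opprB addrCA subrr addr0; apply; lra.
Qed.

(** * Polarization *)

Section Polarization.
Variables (R : realType) (X : normedModType R[i]).

Lemma multilinearD m (A : ('I_m -> X) -> Cx R) v i x y : multilinear A ->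
  A (dfwith v i (x + y)) = A (dfwith v i x) + A (dfwith v i y).
Proof. by move=> /(_ v i 1 x y); rewrite !scale1r. Qed.

Lemma multilinear0 m (A : ('I_m -> X) -> Cx R) v i : multilinear A ->
  A (dfwith v i 0) = 0.
Proof.
move=> mA; have := multilinearD v i 0 0 mA; rewrite addr0 => /eqP.
by rewrite -subr_eq subrr eq_sym => /eqP.
Qed.

Lemma multilinearZ m (A : ('I_m -> X) -> Cx R) v i a x : multilinear A ->
  A (dfwith v i (a *: x)) = a * A (dfwith v i x).
Proof.
by move=> mA; have := mA v i a x 0; rewrite !addr0 multilinear0// addr0.
Qed.

(** Unlike an iterated [dfwith], this makes the variables of [S] range together
    over the diagonal. *)
Definition upd m (v : 'I_m -> X) (S : seq 'I_m) (x : X) : 'I_m -> X :=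
  fun i => if i \in S then x else v i.

Lemma upd_cons m (v : 'I_m -> X) i S x : upd v (i :: S) x = dfwith (upd v S x) i x.
Proof.
apply/funext => j; rewrite /upd in_cons; case: (dfwithP _ _ j) => [|j' ij'].
  by rewrite eqxx.
by rewrite eq_sym (negbTE ij').
Qed.

Lemma upd_dfwith m (v : 'I_m -> X) i S x y : i \notin S ->
  dfwith (upd v S x) i y = upd (dfwith v i y) S x.
Proof.
move=> iS; apply/funext => j; rewrite /upd; case: (dfwithP _ _ j) => [|j' ij'].
  by rewrite (negbTE iS) dfwithin.
by rewrite dfwithout.
Qed.

Lemma upd_all m (v : 'I_m -> X) x : upd v (enum 'I_m) x = (fun=> x).
Proof. by apply/funext => i; rewrite /upd mem_enum. Qed.

(** Moving along a line, the value of the form is a polynomial in the parameter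
    and its coefficient of degree one collects the terms with a single [y]. *)
Lemma multilinear_poly m (A : ('I_m -> X) -> Cx R) (x y : X) (S : seq 'I_m) :
  multilinear A -> uniq S -> forall v : 'I_m -> X, exists p : {poly R[i]},
  [/\ forall l : R[i], p.[l] = A (upd v S (x + l *: y)), p`_0 = A (upd v S x) &
      p`_1 = \sum_(i <- S) A (dfwith (upd v S x) i y)].
Proof.
move=> mA; elim: S => [_ v|i S IH /= /andP[iS uS] v].
  exists (A v)%:P; split=> [l||]; rewrite ?hornerC ?coefC ?big_nil//.
have [p [pE p0 p1]] := IH uS (dfwith v i x).
have [r [rE r0 r1]] := IH uS (dfwith v i y).
exists (p + r * 'X); split=> [l||].
- rewrite hornerD hornerMX pE rE upd_cons multilinearD// multilinearZ//.
  by rewrite !upd_dfwith// mulrC.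
- by rewrite coefD coefMX/= addr0 p0 upd_cons upd_dfwith.
rewrite coefD coefMX/= p1 r0 big_cons upd_cons addrC; congr (_ + _).
  congr A; apply/funext => j; rewrite /upd; case: (dfwithP _ _ j) => [|j' ij'].
    by rewrite (negbTE iS) dfwithin.
  by rewrite !dfwithout.
by rewrite (upd_dfwith _ _ _ iS).
Qed.

Lemma poly_horner_eq0 (p : {poly R[i]}) : (forall l, p.[l] = 0) -> p = 0.
Proof.
move=> p0; pose rs : seq R[i] := [seq n%:R | n <- iota 0 (size p)].
have rootp : all (root p) rs by apply/allP => l _; rewrite /root p0.
apply: roots_geq_poly_eq0 rootp _ _; last by rewrite size_map size_iota.
by rewrite map_inj_uniq ?iota_uniq// => a b /eqP; rewrite eqr_nat => /eqP.
Qed.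

Lemma symmetric_dfwith m (A : ('I_m -> X) -> Cx R) (x y : X) (i j : 'I_m) :
  Defs.symmetric_form A -> A (dfwith (fun=> x) i y) = A (dfwith (fun=> x) j y).
Proof.
move=> sA; rewrite -(sA (tperm i j)); congr A; apply/funext => k /=.
case: (tpermP i j k) => [->|->|/eqP ki /eqP kj].
- have [ij|ij] := eqVneq i j; first by rewrite ij dfwithin.
  by rewrite !dfwithout// eq_sym.
- by rewrite !dfwithin.
- by rewrite !dfwithout// eq_sym.
Qed.

Lemma ocons0 (T : Type) m (x : T) (v : 'I_m -> T) : ocons x v ord0 = x.
Proof. by rewrite /ocons unlift_none. Qed.

Lemma ocons_lift (T : Type) m (x : T) (v : 'I_m -> T) i : ocons x v (lift ord0 i) = v i.
Proof. by rewrite /ocons liftK. Qed.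

Lemma oconsP (T : Type) m (w : 'I_m.+1 -> T) : ocons (w ord0) (w \o lift ord0) = w.
Proof.
by apply/funext => i; case: (unliftP ord0 i) => [j|] ->; rewrite ?ocons0 ?ocons_lift.
Qed.

(** Polarization. The polynomial [l |-> A (x + l y, ..., x + l y)] vanishes, so
    its coefficient of degree one, which is [m] times [A (y, x, ..., x)] by
    symmetry, vanishes too; then induction applies to [A (y, _)]. *)
Lemma polarization0 m (A : ('I_m -> X) -> Cx R) : multilinear A ->
  Defs.symmetric_form A -> (forall x, A (fun=> x) = 0) -> forall v, A v = 0.
Proof.
elim: m A => [|m IH] A mA sA A0 v.
  by rewrite -(A0 0); congr A; apply/funext => -[].
rewrite -(oconsP v); set y := v ord0.
apply: (IH (fun w => A (ocons y w))) => [w i a x1 x2|s w|x].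
- have E x : ocons y (dfwith w i x) = dfwith (ocons y w) (lift ord0 i) x.
    apply/funext => j; case: (unliftP ord0 j) => [k|] ->.
      rewrite ocons_lift; have [->|ki] := eqVneq k i; first by rewrite !dfwithin.
      by rewrite !dfwithout ?ocons_lift// eq_sym// (inj_eq lift_inj).
    by rewrite ocons0 dfwithout ?ocons0// eq_sym neq_lift.
  by rewrite !E; exact: mA.
- rewrite -[RHS](sA (lift_perm ord0 ord0 s)); congr A; apply/funext => j.
  case: (unliftP ord0 j) => [k|] -> /=.
    by rewrite ocons_lift lift_perm_lift ocons_lift.
  by rewrite ocons0 lift_perm_id ocons0.
have [p [pE _ p1]] := multilinear_poly x y mA (enum_uniq 'I_m.+1) (fun=> x).
have p0 : p = 0 by apply: poly_horner_eq0 => l; rewrite pE upd_all A0.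
move: p1; rewrite p0 coef0 upd_all.
under eq_bigr => i _ do rewrite (symmetric_dfwith x y i ord0 sA).
rewrite big_const_seq count_predT -cardE card_ord iter_addr addr0 => /eqP.
rewrite eq_sym mulrn_eq0 /= => /eqP <-; congr A; apply/funext => j.
case: (unliftP ord0 j) => [k|] ->; first by rewrite ocons_lift dfwithout// neq_lift.
by rewrite ocons0 dfwithin.
Qed.

Lemma associated_form_unique m (P : X -> Cx R) A B :
  associated_form (m := m) P A -> associated_form P B -> A = B.
Proof.
move=> [mA sA _ PA] [mB sB _ PB]; apply/funext => v; apply/eqP; rewrite -subr_eq0.
apply/eqP; apply: (@polarization0 m (fun v => A v - B v)) => [w i a x y|s w|x].
- rewrite mA mB -[RHS]/(a * (A (dfwith w i x) - B (dfwith w i x)) + _).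
  by rewrite mulrBr opprD addrACA.
- by rewrite sA sB.
- by rewrite -PA -PB subrr.
Qed.

Lemma homogeneousZ m (P : X -> Cx R) : homogeneous_polynomial m P ->
  forall a x, P (a *: x) = a ^+ m * P x.
Proof.
move=> [A [mA _ _ PA]] a x; rewrite !PA.
suff E (S : seq 'I_m) : uniq S ->
    A (upd (fun=> x) S (a *: x)) = a ^+ size S * A (fun=> x).
  by rewrite -(upd_all (fun=> x) (a *: x)) E ?enum_uniq// -cardE card_ord.
elim: S => [_|i S IH /= /andP[iS uS]]; first by rewrite expr0 mul1r.
rewrite upd_cons multilinearZ// exprS -mulrA -IH//; congr (_ * _); congr A.
apply/funext => j; rewrite /upd; case: (dfwithP _ _ j) => // .
by rewrite (negbTE iS).
Qed.

End Polarization.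

(** * Weak-star limits along the space *)

Section WeakStarTrace.
Variables (R : realType) (X : normedModType R[i]).

(** Points of [X] that agree with [z] on finite families of functionals, which
    exist by interpolation, converge to [z] in the weak-star topology. *)
Lemma weak_star_nbhs_meets (z : bidual X) (V : set (bidual X)) :
  nbhs (z : weak_star (dual X)) V -> exists x, V (canonical_embedding x).
Proof.
pose D (s : seq (dual X)) := [set x : X | forall u, u \in s -> u x = z u].
pose G := filter_from [set: seq (dual X)] D.
have GF : ProperFilter G.
  apply: filter_from_proper.
    apply: filter_from_filter; first by exists [::].
    move=> s t _ _; exists (s ++ t) => // x Dx.
    by split=> u us; apply: Dx; rewrite mem_cat us ?orbT.
  move=> s _; have [x xE] := finite_interpolation (size s) (nth 0 s) z.
  by exists x => u us; rewrite -(nth_index 0 us) xE ?index_mem.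
pose E x : {ptws dual X -> Cx R} := canonical_embedding x.
have cE : E @ G --> (z : {ptws dual X -> Cx R}).
  apply/cvg_sup => u; apply/cvg_image.
    by rewrite eqEsubset; split=> // c _; exists (fun=> c).
  move=> B Bzu; exists (proj u @^-1` B).
    exists [:: u] => // x /(_ u); rewrite mem_head => /(_ isT) xu.
    by rewrite /= /proj /E /canonical_embedding /= xu; exact: nbhs_singleton.
  by rewrite image_preimage// eqEsubset; split=> // c _; exists (fun=> c).
rewrite nbhsE => -[W [[B oB <-] Bz] WV].
have GB : G (E @^-1` B) by apply: cE; exact: open_nbhs_nbhs.
by have [x Bx] := filter_ex GB; exists x; exact: WV.
Qed.

(** Weak-star density of [X] in its bidual: limits along the trace are unique. *)
Lemma weak_star_trace_proper (z : bidual X) : ProperFilter (weak_star_trace z).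
Proof.
apply: filter_from_proper.
  apply: filter_from_filter; first by exists setT; exact: filterT.
  by move=> V W nV nW; exists (V `&` W) => //; exact: filterI.
by move=> V /weak_star_nbhs_meets[x Vx]; exists x.
Qed.

Lemma weak_star_trace_eval (z : bidual X) (u : dual X) :
  u x @[x --> weak_star_trace z] --> z u.
Proof.
have cts : continuous ((fun w : weak_star (dual X) => (w : bidual X) u) :
    weak_star (dual X) -> Cx R).
  move=> w; apply: (@continuous_comp (weak_star (dual X)) {ptws dual X -> Cx R} (Cx R)
    (fun w => (w : dual X -> Cx R)) (proj u)); first exact: initial_continuous.
  exact: proj_continuous.
move=> B /(cts z) Bz.
by exists ((fun w : bidual X => w u) @^-1` B).
Qed.

End WeakStarTrace.

(** * Powers of a functional and Taylor series *)

Section PowersOfFunctional.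
Variables (R : realType) (X : normedModType R[i]).

Definition power_form m (a : Cx R) (u : dual X) (v : 'I_m -> X) : Cx R :=
  a * \prod_(i < m) u (v i).

Lemma power_form_associated m (a : Cx R) (u : dual X) :
  associated_form (m := m) (fun x => a * u x ^+ m) (power_form a u).
Proof.
split.
- move=> v i b x y.
  have E c : power_form a u (dfwith v i c) =
      a * (u c * \prod_(j < m | j != i) u (v j)).
    rewrite /power_form (bigD1 i)//= dfwithin; congr (_ * (_ * _)).
    by apply: eq_bigr => j ji; rewrite dfwithout// eq_sym.
  rewrite !E linD linZ -[_ *: _]/(b * (a * (u x * _))); ring.
- move=> s v; congr (a * _).
  by rewrite [RHS](reindex_inj (@perm_inj _ s)); apply: eq_bigr.
- have cu i : continuous (fun w : {ptws 'I_m -> X} => u (w i) : Cx R).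
    move=> w; apply: (@continuous_comp {ptws 'I_m -> X} X (Cx R) (proj i) u).
      exact: proj_continuous.
    exact: dual_continuous.
  have cP := @continuous_big (Cx R) 'I_m *%R 1 predT (@mul_continuous (Cx R))
    {ptws 'I_m -> X} (index_enum 'I_m) (fun i w => u (w i)) (fun i _ => cu i).
  exact: (fun v => @cvgM _ {ptws 'I_m -> X} (nbhs v) _ (fun=> a) _ a _
    (cvg_cst a) (cP v)).
- by move=> x; rewrite /power_form prodr_const card_ord.
Qed.

Lemma form_extension_power m (a : Cx R) (u : dual X) (z : 'I_m -> bidual X) :
  form_extension (power_form a u) z = a * \prod_(i < m) z i u.
Proof.
elim: m a z => [|m IH] a z; first by rewrite /= /power_form !big_ord0.
rewrite /= big_ord_recl.
have E x : form_extension (fun v => power_form a u (ocons x v)) (z \o lift ord0) =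
    (a * \prod_(i < m) (z (lift ord0 i)) u) * u x :> Cx R.
  have -> : (fun v => power_form a u (ocons x v)) = power_form (m := m) (a * u x) u.
    apply/funext => v; rewrite /power_form big_ord_recl ocons0 mulrA; congr (_ * _).
    by apply: eq_bigr => i _; rewrite ocons_lift.
  by rewrite IH /= mulrAC.
under eq_fun do rewrite E.
have PF := weak_star_trace_proper (z ord0).
apply: cvg_lim => //.
rewrite [X in _ --> X](_ : _ = (a * \prod_(i < m) (z (lift ord0 i)) u) * z ord0 u).
  by apply: cvgM; [exact: cvg_cst|exact: weak_star_trace_eval].
by rewrite -mulrA [in RHS](mulrC _ (z ord0 u)).
Qed.

(** By polarization, the form named by [polynomial_extension] is the product
    form, each variable of which extends weak-star continuously. *)
Lemma polynomial_extension_power m (P : X -> Cx R) (a : Cx R) (u : dual X) z :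
  (forall x, P x = a * u x ^+ m) -> polynomial_extension m P z = a * z u ^+ m.
Proof.
move=> PE; have -> : P = fun x => a * u x ^+ m by apply/funext.
have aP := power_form_associated m a u.
rewrite /polynomial_extension.
rewrite (associated_form_unique (getPex (ex_intro _ _ aP)) aP).
by rewrite form_extension_power prodr_const card_ord.
Qed.

Lemma homogeneous_power m (a : Cx R) (u : dual X) :
  homogeneous_polynomial m (fun x => a * u x ^+ m).
Proof. by exists (power_form a u); exact: power_form_associated. Qed.

End PowersOfFunctional.

Section Taylor.
Variable R : realType.

(** The coefficient of lowest degree of a null power series is dominated by
    the geometric tail of the following ones. *)
Lemma null_power_series (c : nat -> Cx R) (rho : R) : 0 < rho ->
  (forall l : R, 0 < l -> l < rho -> forall e : R, 0 < e -> exists N, forall n, (N <= n)%N ->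
    nrm (\sum_(m < n) c m * l%:C ^+ m : Cx R) <= e) ->
  forall m, c m = 0.
Proof.
move=> rho0 hc.
pose l0 := rho / 2.
have l00 : 0 < l0 by rewrite divr_gt0.
have l0rho : l0 < rho by rewrite /l0; lra.
have [M M0 cM] : exists2 M : R, 0 < M & forall n, nrm (c n) * l0 ^+ n <= M.
  have [N hN] := hc l0 l00 l0rho 1 ltr01.
  have tail n : (N <= n)%N -> nrm (c n) * l0 ^+ n <= 2.
    move=> Nn; have := hN n Nn; have := hN n.+1 (leqW Nn); rewrite big_ord_recr /=.
    set S := \sum_(_ < _) _ => h1 h2.
    have := nrmB (S + c n * l0%:C ^+ n) S; rewrite addrAC subrr add0r.
    rewrite nrmM nrmX nrm_real gtr0_norm//; lra.
  exists (2 + \sum_(n < N) nrm (c n) * l0 ^+ n).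
    rewrite ltr_wpDr// sumr_ge0// => i _.
    by rewrite mulr_ge0 ?nrm_ge0// exprn_ge0// ltW.
  move=> n; have [nN|Nn] := ltnP n N; last first.
    rewrite (le_trans (tail n Nn))// lerDl sumr_ge0// => i _.
    by rewrite mulr_ge0 ?nrm_ge0// exprn_ge0// ltW.
  rewrite (bigD1 (Ordinal nN))//= addrCA lerDl addr_ge0// sumr_ge0// => i _.
  by rewrite mulr_ge0 ?nrm_ge0// exprn_ge0// ltW.
move=> m; elim/ltn_ind: m => m IH.
suff small t : 0 < t -> t <= 1 / 2 -> nrm (c m) * l0 ^+ m <= 3 * M * t.
  have : nrm (c m) * l0 ^+ m <= 0.
    apply/ler_addgt0Pl => e e0; rewrite addr0.
    pose t := Num.min (1 / 2) (e / (3 * M)).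
    have t0 : 0 < t.
      by rewrite lt_min; apply/andP; split; [lra|rewrite divr_gt0// mulr_gt0].
    have [t1 t2] : t <= 1 / 2 /\ t <= e / (3 * M).
      by split; rewrite /t ge_min lexx ?orbT.
    rewrite (le_trans (small t t0 t1))//.
    by move: t2; rewrite ler_pdivlMr ?mulr_gt0// mulrC.
  rewrite pmulr_lle0 ?exprn_gt0// => h.
  by apply: nrm_eq0; apply/eqP; rewrite eq_le h nrm_ge0.
move=> t0 t1.
have tl0 : 0 < t * l0 by rewrite mulr_gt0.
have tlrho : t * l0 < rho.
  have : t * l0 <= 1 / 2 * l0 by rewrite ler_pM2r.
  by clear -l0rho l00; lra.
have tm0 : 0 < t ^+ m by rewrite exprn_gt0.
have e0 : 0 < M * t ^+ m.+1 by rewrite !mulr_gt0 ?exprn_gt0.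
have [N hN] := hc (t * l0) tl0 tlrho _ e0.
have := hN (m.+1 + N)%N (leq_addl _ _).
rewrite big_split_ord /= big_ord_recr /= big1 => [|i _]; last first.
  by rewrite IH ?mul0r.
rewrite add0r => h.
have tailN K : nrm (\sum_(i < K) c (m.+1 + i)%N * (t * l0)%:C ^+ (m.+1 + i) : Cx R)
    <= M * t ^+ m.+1 * (2 - 2 * t ^+ K).
  elim: K => [|K IHK].
    by rewrite big_ord0 nrm0 expr0 mulr1 subrr mulr0.
  rewrite big_ord_recr /= (le_trans (nrmD _ _))//.
  have : nrm (c (m.+1 + K)%N * (t * l0)%:C ^+ (m.+1 + K) : Cx R) <= M * t ^+ m.+1 * t ^+ K.
    rewrite nrmM nrmX nrm_real gtr0_norm// exprMn mulrCA mulrC.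
    by rewrite -mulrA -exprD ler_pM2r ?exprn_gt0.
  move: IHK; rewrite [t ^+ K.+1]exprS; have : 0 < t ^+ K by rewrite exprn_gt0.
  move: (nrm _) (nrm _) (t ^+ K) => A B C C0 hA hB.
  have : M * t ^+ m.+1 * (t * C) <= M * t ^+ m.+1 * (1 / 2 * C).
    by rewrite ler_pM2l// ler_pM2r.
  lra.
have hm : nrm (c m * (t * l0)%:C ^+ m : Cx R) <= 3 * (M * t ^+ m.+1).
  move: h; set S := \sum_(_ < _) _ => h.
  have := nrmB (c m * (t * l0)%:C ^+ m + S) S; rewrite addrK.
  have := tailN N; rewrite -/S.
  have : 0 <= M * t ^+ m.+1 * t ^+ N by rewrite mulr_ge0 ?exprn_ge0 ?ltW.
  lra.
move: hm; rewrite nrmM nrmX nrm_real gtr0_norm// exprMn exprS.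
have -> : 3 * (M * (t * t ^+ m)) = (3 * M * t) * t ^+ m by ring.
by rewrite mulrCA mulrC ler_pM2r.
Qed.

Variable X : normedModType R[i].

Lemma uniform_ballP (f : X -> Cx R) (a : X) (r : R) (F : nat -> X -> Cx R) :
  {uniform ball a r%:C, F @ \oo --> f} <->
  forall e : R, 0 < e -> exists N, forall n, (N <= n)%N ->
    forall x, nrm (x - a) < r -> nrm (f x - F n x) <= e.
Proof.
have ballE x : ball a r%:C x <-> nrm (x - a) < r.
  by rewrite -ball_normE /= -nrmE ltcR -nrmN opprB.
split=> [cF e e0|H P /uniform_nbhs[E [entE EP]]].
  have e0C : 0 < e%:C :> R[i] by rewrite -[0]/(0%:C) ltcR.
  have : (F @ \oo) [set g | forall x, ball a r%:C x -> ball (f x) e%:C (g x)].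
    apply: cF; apply/uniform_nbhs.
    exists [set xy | ball xy.1 e%:C xy.2]; split=> //.
    by rewrite -entourage_ballE; exists e%:C.
  case=> N _ hN; exists N => n Nn x /ballE xa.
  have := hN n Nn x xa; rewrite -ball_normE /= -nrmE ltcR; exact: ltW.
move: entE; rewrite -entourage_ballE => -[e /= e0 eE].
have e0' : 0 < rePart e by move: e0; rewrite ltcE => /andP[].
have eRE : e = (rePart e)%:C by rewrite RRe_real// gtr0_real.
have [N hN] := H (rePart e / 2) (divr_gt0 e0' (ltr0n _ 2)).
exists N => // n Nn; apply: EP => x /ballE xa; apply: eE => /=.
rewrite -ball_normE /= -nrmE eRE ltcR (le_lt_trans (hN n Nn x xa))//; lra.
Qed.

(** On each complex line through [0], the two series are power series in one
    variable. *)
Lemma taylor_unique (f : X -> Cx R) (P Q : nat -> X -> Cx R) :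
  power_series_at f 0 P -> power_series_at f 0 Q -> forall m x, P m x = Q m x.
Proof.
move=> [hP [r r0 /uniform_ballP cP]] [hQ [s s0 /uniform_ballP cQ]] m x.
apply/eqP; rewrite -subr_eq0; apply/eqP.
pose rho := Num.min r s / (nrm x + 1).
have nx1 : 0 < nrm x + 1 by rewrite ltr_wpDl ?nrm_ge0.
have rs0 : 0 < Num.min r s by rewrite lt_min r0.
apply: (@null_power_series (fun m => P m x - Q m x) rho) => [|l l0 lrho e e0].
  by rewrite divr_gt0.
have lx : nrm (l%:C *: x - 0) < Num.min r s.
  rewrite subr0 nrmZ nrm_real gtr0_norm//; move: lrho; rewrite ltr_pdivlMr//; nra.
have [lr ls] : nrm (l%:C *: x - 0) < r /\ nrm (l%:C *: x - 0) < s.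
  by apply/andP; rewrite -lt_min.
have e20 : 0 < e / 2 by rewrite divr_gt0.
have [N1 h1] := cP _ e20; have [N2 h2] := cQ _ e20.
exists (maxn N1 N2) => n; rewrite geq_max => /andP[n1 n2].
have := h1 n n1 _ lr; have := h2 n n2 _ ls.
have E (T : nat -> X -> Cx R) : (forall m, homogeneous_polynomial m (T m)) ->
    \sum_(m < n) T m (l%:C *: x - 0) = \sum_(m < n) T m x * l%:C ^+ m.
  by move=> hT; apply: eq_bigr => i _; rewrite subr0 (homogeneousZ (hT i)) mulrC.
rewrite !E// => h3 h4.
have -> : \sum_(m < n) (P m x - Q m x) * l%:C ^+ m =
    (f (l%:C *: x) - \sum_(m < n) Q m x * l%:C ^+ m) -
    (f (l%:C *: x) - \sum_(m < n) P m x * l%:C ^+ m).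
  under eq_bigr do rewrite mulrBl.
  by rewrite sumrB; ring.
rewrite (le_trans (nrmB _ _))//; lra.
Qed.

End Taylor.

(** * Composition with a functional *)

Section Composition.
Variables (R : realType) (X : normedModType R[i]) (u : dual X) (g : Cx R -> Cx R).
Hypothesis u1 : nrm u = 1.
Hypothesis u_lt1 : forall x, nrm x <= 1 -> nrm (u x) < 1.
Hypothesis g_bounded : forall w : Cx R, nrm w < 1 -> nrm (g w) <= 2.
Hypothesis g_expansion : forall a : Cx R, nrm a < 1 -> exists c : nat -> Cx R,
  forall (h : Cx R) (n : nat), let rho := nrm (1 - a : Cx R) in
  nrm h < rho -> nrm (a + h : Cx R) < 1 ->
  nrm (g (a + h) - \sum_(m < n) c m * h ^+ m) <=
    2 * (nrm h / rho) ^+ n / (rho - nrm h).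

Lemma ball0E (V : normedModType R[i]) (x : V) : ball 0 1 x <-> nrm x < 1.
Proof. by rewrite -ball_normE /= sub0r normrN -nrmE -[1]/(1%:C) ltcR. Qed.

Lemma one_sub_gt0 (a : Cx R) : nrm a < 1 -> 0 < nrm (1 - a : Cx R).
Proof.
move=> a1; have := nrmD (1 - a : Cx R) a; rewrite subrK nrm1; lra.
Qed.

Lemma nrm_u x : nrm (u x) <= nrm x.
Proof. by apply: nrm_dual_le1; rewrite u1. Qed.

Lemma geometric_small (rho d : R) : 0 < rho -> 0 < d ->
  exists N, forall n, (N <= n)%N -> 2 * (1 / 2) ^+ n / rho <= d.
Proof.
move=> rho0 d0.
have cv : (fun n => (1 / 2 : R) ^+ n) @ \oo --> (0 : R).
  by apply: cvg_expr; rewrite gtr0_norm//; lra.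
have e0 : 0 < d * rho / 2 by rewrite divr_gt0 ?mulr_gt0.
have [N _ hN] := cvgr_lt _ cv _ e0.
exists N => n /hN /= h; rewrite ler_pdivrMr//; lra.
Qed.

Lemma composition_power_series (a : X) (c : nat -> Cx R) : nrm a < 1 ->
  (forall (h : Cx R) (n : nat), let rho := nrm (1 - u a : Cx R) in
    nrm h < rho -> nrm (u a + h : Cx R) < 1 ->
    nrm (g (u a + h) - \sum_(m < n) c m * h ^+ m) <=
      2 * (nrm h / rho) ^+ n / (rho - nrm h)) ->
  power_series_at (fun x => g (u x)) a (fun m x => c m * u x ^+ m).
Proof.
move=> a1 hc; split=> [m|]; first exact: homogeneous_power.
have ua1 := u_lt1 (ltW a1).
pose rho := nrm (1 - u a : Cx R).
have rho0 : 0 < rho by exact: one_sub_gt0.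
exists (Num.min (rho / 2) (1 - nrm a)).
  by rewrite lt_min divr_gt0//= subr_gt0.
apply/uniform_ballP => e e0.
have [N hN] := geometric_small (divr_gt0 rho0 (ltr0n _ 2)) e0.
exists N => n /hN hn x; rewrite lt_min => /andP[x1 x2].
have hu : nrm (u (x - a)) < rho / 2 by exact: le_lt_trans (nrm_u _) x1.
have uxE : u a + u (x - a) = u x by rewrite linB addrC subrK.
have ux1 : nrm (u a + u (x - a) : Cx R) < 1.
  rewrite uxE; apply: u_lt1; have := nrmD (x - a) a; rewrite subrK; lra.
have hur : nrm (u (x - a)) < rho by lra.
have := hc _ n hur ux1; rewrite uxE -/rho => /le_trans; apply; apply: le_trans hn.
apply: ler_pM.
- by rewrite mulr_ge0// exprn_ge0// divr_ge0 ?nrm_ge0.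
- by rewrite invr_ge0; lra.
- rewrite ler_pM2l//; apply: lerXn2r; rewrite ?nnegrE.
  + exact: divr_ge0 (nrm_ge0 _) (nrm_ge0 _).
  + lra.
  by rewrite ler_pdivrMr//; lra.
rewrite lef_pV2 ?posrE; lra.
Qed.

Lemma g_continuous (w : Cx R) : nrm w < 1 -> g v @[v --> w] --> g w.
Proof.
move=> w1; apply: (cvgrPdist_le (FF := nbhs_filter w) g (g w)).2 => e e0.
have e0' : 0 < rePart e by move: e0; rewrite ltcE => /andP[].
have eRE : e = (rePart e)%:C by rewrite RRe_real// gtr0_real.
have [c hc] := g_expansion w1.
pose rho := nrm (1 - w : Cx R).
have rho0 : 0 < rho by exact: one_sub_gt0.
have gw : g w = c 0.
  have := hc 0 1%N; rewrite /= nrm0 addr0 big_ord_recl big_ord0 expr0 mulr1 addr0.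
  rewrite mul0r expr1 mulr0 mul0r => /(_ rho0 w1) h.
  by apply/eqP; rewrite -subr_eq0; apply/eqP/nrm_eq0/eqP; rewrite eq_le h nrm_ge0.
pose d := Num.min (Num.min (rho / 2) (1 - nrm w)) (rePart e * rho ^+ 2 / 4).
have d0 : 0 < d.
  by rewrite !lt_min subr_gt0 w1 !divr_gt0 ?mulr_gt0 ?exprn_gt0.
have dC : 0 < d%:C :> R[i] by rewrite -[0]/(0%:C) ltcR.
near=> v.
have : nrm (v - w : Cx R) < d.
  rewrite -ltcR nrmE distrC; near: v.
  by apply: (@cvgr_dist_lt _ _ _ (nbhs w) _ id w) => //; exact: cvg_id.
rewrite /d !lt_min => /andP[/andP[h1 h2] h3].
have vE : w + (v - w) = v by rewrite addrC subrK.
have h4 : nrm (v - w : Cx R) < rho by lra.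
have h5 : nrm (w + (v - w) : Cx R) < 1.
  by apply: le_lt_trans (nrmD _ _) _; lra.
have := hc _ 1%N h4 h5; rewrite vE big_ord_recl big_ord0 expr0 mulr1 addr0 -gw expr1.
rewrite -/rho eRE -nrmE lecR -nrmN opprB => /le_trans; apply.
have r2 : 0 < rho - nrm (v - w : Cx R) by lra.
rewrite ler_pdivrMr// mulrA ler_pdivrMr//.
move: h1 h3; move: (nrm _) (nrm_ge0 (v - w : Cx R)) => t t0 h1 h3.
have : rePart e * (rho / 2) * rho <= rePart e * (rho - t) * rho.
  by rewrite ler_pM2r// ler_pM2l//; lra.
lra.
Unshelve. all: by end_near. Qed.

(** Continuity on the closed ball only involves [g] on the open disc, because
    [u] does not attain its norm. *)
Lemma composition_A_infty : A_infty (fun x => g (u x)).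
Proof.
split.
- move=> a /ball0E a1; have [c hc] := g_expansion (u_lt1 (ltW a1)).
  exists (fun m x => c m * u x ^+ m); exact: composition_power_series.
- rewrite /bounded_near /=; near=> M => x /ball0E x1; rewrite /=.
  apply: (@le_trans _ _ (2%:C : R[i])).
    by rewrite -nrmE lecR g_bounded// u_lt1// ltW.
  by near: M; apply: nbhs_pinfty_ge; rewrite ger0_real// ler0c.
exists (fun x => g (u x)) => //.
apply: continuous_in_subspaceT => x /set_mem /= x1.
apply: (@continuous_comp X (Cx R) (Cx R) u g); first exact: dual_continuous.
apply: g_continuous; apply: u_lt1; by rewrite -lecR nrmE.
Unshelve. all: by end_near. Qed.

Lemma aron_berner_composition (z : bidual X) : nrm z < 1 ->
  aron_berner (fun x => g (u x)) z = g (z u).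
Proof.
move=> z1.
have n0 : nrm (0 : X) < 1 by rewrite nrm0.
have [c hc] := g_expansion (u_lt1 (ltW n0)).
have ps := composition_power_series n0 hc.
have TE m x : taylor_series (fun x => g (u x)) m x = c m * u x ^+ m.
  exact: (taylor_unique (getPex (ex_intro _ _ ps)) ps).
apply: cvg_lim => //; apply/cvgrPdist_le => e e0.
have e0' : 0 < rePart e by move: e0; rewrite ltcE => /andP[].
have eRE : e = (rePart e)%:C by rewrite RRe_real// gtr0_real.
have zu1 : nrm (z u) < 1.
  by apply: le_lt_trans z1; have := nrm_dual_ge z u; rewrite u1 mulr1.
move: hc; rewrite lin0 /= subr0 nrm1 => hc.
have cv : (fun n => nrm (z u) ^+ n) @ \oo --> (0 : R).
  by apply: cvg_expr; rewrite ger0_norm ?nrm_ge0.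
have d0 : 0 < rePart e * (1 - nrm (z u)) / 2 by rewrite divr_gt0 ?mulr_gt0// subr_gt0.
have [N _ hN] := cvgr_lt _ cv _ d0.
exists N => // n /hN /= hn.
under eq_bigr do rewrite (polynomial_extension_power z (TE _)).
have := hc (z u) n zu1; rewrite add0r divr1 => /(_ zu1) h.
rewrite eRE -nrmE lecR (le_trans h)// ler_pdivrMr ?subr_gt0//; lra.
Qed.

End Composition.

Lemma james_unit (R : realType) (X : completeNormedModType R[i]) :
  ~ reflexive_space X -> exists2 u : dual X, nrm u = 1 &
    forall x, nrm x <= 1 -> nrm (u x) < 1.
Proof.
move=> /nonreflexive_system[th [f [x [th0 f1 x1 fx0 fxth]]]].
have [z z0 hz] := james_nonattaining th0 f1 x1 fx0 fxth.
exists ((nrm z)^-1%:C *: z) => [|y y1].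
  by rewrite nrmZ nrm_real gtr0_norm ?invr_gt0// mulVf// gt_eqF.
by rewrite dualZx nrmM nrm_real gtr0_norm ?invr_gt0// ltr_pdivrMl// mulr1 hz.
Qed.

Theorem proposition4p1 (R : realType) (X : completeNormedModType R[i]) :
  ~ reflexive_space X ->
  exists f : X -> Cx R,
    A_infty f /\ ~ A_infty (aron_berner f).
Proof.
move=> /james_unit[u u1 u_lt1].
have [g [gb ge g_nolim]] := bounded_analytic_no_radial_limit R.
exists (fun x => g (u x)); split; first exact: composition_A_infty.
move=> [_ _ [G cG GE]].
(* The point of the bidual where [u] attains its norm; on the radius through it,
   the extension takes the values of [g] on the real radius. *)
have [z z1 zu] := norming_functional u.
apply: (g_nolim (rePart (G z))) => d d0.
have dC : 0 < d%:C :> R[i] by rewrite -[0]/(0%:C) ltcR.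
pose B := [set w : bidual X | `|w| <= 1].
have Bz : B z by rewrite /B /= -nrmE -[1]/(1%:C) lecR.
have cGz := (subspace_continuousP B G).1 cG z Bz.

have /cvgrPdist_lt/(_ _ dC) := cGz.
move=> /nbhs_ballP[e /= e0 he].
have e0' : 0 < rePart e by move: e0; rewrite ltcE => /andP[].
have eRE : e = (rePart e)%:C by rewrite RRe_real// gtr0_real.
exists (Num.min (rePart e) 1); first by rewrite lt_min e0' /=.
move=> t te t1.
have [te' t0] : 1 - rePart e < t /\ 0 < t.
  by move: te; rewrite /Num.min; case: ifP => h; lra.
pose y := t%:C *: z.
have ny : nrm y < 1.
  rewrite nrmZ nrm_real gtr0_norm//; have := nrm_ge0 z; nra.
have yz : ball z e y.
  rewrite -ball_normE /= -nrmE eRE ltcR.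
  have -> : z - y = (1 - t)%:C *: z by rewrite rmorphB scalerBl scale1r.
  rewrite nrmZ nrm_real gtr0_norm ?subr_gt0//; have := nrm_ge0 z; nra.
have By : B y by rewrite /B /= -nrmE -[1]/(1%:C) lecR ltW.
have := he y yz By; rewrite -nrmE ltcR (GE y ((ball0E y).2 ny)).
rewrite aron_berner_composition// dualZx zu u1 mulr1 => h.
rewrite distrC -ReB; exact: le_lt_trans (absRe_le _) h.
Qed.
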